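(* Let $m=m_n$ and let $m,n\to\infty$. Assume that $\frac{m}{n}\to\mu\in(0,\infty)$, that $P^{(n)}\to P$ weakly, and that $P^{(n)}_{rs}\to P_{rs}<\infty$ for $rs=10,21,32,43$, for some probability measure $P$ on $\mathbb{Z}_+\times[0,1]$ such that $P_{10},P_{21}>0$. Then the model assortativity of the superposition random graph $G_n$ converges according to $$\mathrm{Cor}^*\big(\deg_{G_n}(I),\deg_{G_n}(J)\big)\;\longrightarrow\;\frac{P_{21}(P_{43}+P_{33})-P_{32}^2}{P_{21}(P_{43}+P_{32})-P_{32}^2+\mu P_{21}^2(P_{21}+P_{32})}.$$
   Context: Notation: $\mathbb{Z}_+=\{0,1,2,\dots\}$, $[n]=\{1,\dots,n\}$, $(x)_r=x(x-1)\cdots(x-r+1)$. Model: For each $n$, let $m=m_n$ be the number of layers and $P^{(n)}$ a probability measure on $\{0,\dots,n\}\times[0,1]$. The triples $(G_{n,k},X_{n,k},Y_{n,k})$, $k=1,\dots,m$, are mutually independent, where $(X_{n,k},Y_{n,k})$ has distribution $P^{(n)}$ (size and strength of layer $k$, possibly dependent on each other) and $G_{n,k}$ is a random undirected graph with node set contained in $[n]$ such that: given $(X_{n,k},Y_{n,k})$, $V(G_{n,k})$ is uniformly distributed on the subsets of $[n]$ of size $X_{n,k}$; and given $(V(G_{n,k}),X_{n,k},Y_{n,k})$, each unordered node pair of $V(G_{n,k})$ is linked in $G_{n,k}$ with probability $Y_{n,k}$, independently of other pairs. The superposition graph $G_n$ has $V(G_n)=[n]$ and $E(G_n)=E(G_{n,1})\cup\cdots\cup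 E(G_{n,m})$. Cross moments: $P^{(n)}_{rs}=\mathbb{E}\big((X_{n,k})_rY_{n,k}^s\big)$ and $P_{rs}=\mathbb{E}\big((X)_rY^s\big)$ with $(X,Y)\sim P$. Model assortativity: let $(I,J)$ be an ordered pair of distinct nodes of $[n]$ selected uniformly at random and independently of $E(G_n)$, and let $\mathbb{E}^*$ denote conditional expectation given the event that $\{I,J\}\in E(G_n)$. Then $$\mathrm{Cor}^*(\deg_{G_n}(I),\deg_{G_n}(J))=\frac{\mathbb{E}^*\deg_{G_n}(I)\deg_{G_n}(J)-(\mathbb{E}^*\deg_{G_n}(I))^2}{\mathbb{E}^*\deg_{G_n}(I)^2-(\mathbb{E}^*\deg_{G_n}(I))^2}.$$ *)

(* Defs.v *)
From HB Require Import structures.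
From mathcomp Require Import all_boot all_order all_algebra.
From mathcomp Require Import all_classical all_reals all_analysis.
Import Order.TTheory GRing.Theory Num.Theory.
Import numFieldNormedType.Exports.

Set Implicit Arguments.
Unset Strict Implicit.
Unset Printing Implicit Defensive.

Local Open Scope classical_set_scope.
Local Open Scope ring_scope.

HB.instance Definition _ (T : finType) := isPointed.Build {set T} finset.set0.
HB.instance Definition _ (T : finType) :=
  @isMeasurable.Build default_measure_display {set T} discrete_measurable
    discrete_measurable0 discrete_measurableC discrete_measurableU.

Section graphs.
Variable n : nat.

Definition node_pairs (V : {set 'I_n}) : {set {set 'I_n}} :=
  [set e : {set 'I_n} | (e \subset V) && (#|e| == 2%N)]%SET.

Definition graph :=
  {g : {set 'I_n} * {set {set 'I_n}} | g.2 \subset node_pairs g.1}.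

Definition nodes (g : graph) : {set 'I_n} := (val g).1.
Definition edges (g : graph) : {set {set 'I_n}} := (val g).2.

Definition empty_graph : graph :=
  exist _ (finset.set0, finset.set0) (finset.sub0set _).

HB.instance Definition _ := Finite.on graph.
HB.instance Definition _ := isPointed.Build graph empty_graph.
HB.instance Definition _ :=
  @isMeasurable.Build default_measure_display graph discrete_measurable
    discrete_measurable0 discrete_measurableC discrete_measurableU.

Definition degree (g : graph) (i : 'I_n) : nat :=
  #|[set j | [set i; j] \in edges g]%SET|.

Lemma superpose_subproof m (g : 'I_m -> graph) :
  (\bigcup_(k < m) edges (g k))%SET \subset node_pairs [set: 'I_n]%SET.
Proof.
apply/bigcupsP => k _; apply/fintype.subsetP => e.
move=> /(fintype.subsetP (valP (g k))); rewrite !inE => /andP[_ ->].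
by rewrite finset.subsetT.
Qed.

Definition superpose m (g : 'I_m -> graph) : graph :=
  exist _ ([set: 'I_n]%SET, (\bigcup_(k < m) edges (g k))%SET)
    (superpose_subproof g).

End graphs.

Section probability_notions.
Context {d d' : measure_display} {Omega : measurableType d}
  {S : measurableType d'} {R : realType}.
Variable Pr : probability Omega R.

Definition mutually_independent (I : finType) (W : I -> Omega -> S) : Prop :=
  forall B : I -> set S, (forall k, measurable (B k)) ->
    Pr (\bigcap_k (W k @^-1` B k)) = (\prod_k Pr (W k @^-1` B k))%E.

(* f (W) is a version of the conditional probability of A given W. *)
Definition conditional_probability (A : set Omega) (W : Omega -> S)
    (f : S -> R) : Prop :=
  measurable_fun setT f /\
  forall B : set S, measurable B ->
    Pr (A `&` W @^-1` B) = (\int[Pr]_(w in W @^-1` B) (f (W w))%:E)%E.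

(* Conditioning on an event; the value is 0 when Pr A = 0. *)
Definition conditional_expectation (A : set Omega) (Z : Omega -> R) : R :=
  (\int[Pr]_(w in A) Z w) / fine (Pr A).

End probability_notions.

Section layer_types.
Variable R : realType.

(* Probability measures on Z_+ x [0,1] are encoded as probability measures on
   nat * R that give mass one to [layer_types]. *)
Definition layer_types : set (nat * R) := setT `*` `[0, 1].

Definition finite_layer_types (n : nat) : set (nat * R) :=
  [set x | (x <= n)%N] `*` `[0, 1].

Definition cross_moment (P : probability (nat * R)%type R) (r s : nat) : \bar R :=
  (\int[P]_z ((z.1 ^_ r)%:R * z.2 ^+ s)%:E)%E.

(* The test functions are the bounded continuous functions on the subspace
   Z_+ x [0,1]; nat carries the discrete topology. *)
Definition weakly_converges (Pn : nat -> probability (nat * R)%type R)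
    (P : probability (nat * R)%type R) : Prop :=
  forall f : nat * R -> R,
    {within layer_types, continuous f} ->
    [bounded f z | z in layer_types] ->
    \int[Pn n]_(z in layer_types) f z @[n --> \oo]
      --> \int[P]_(z in layer_types) f z.

End layer_types.

Arguments layer_types {R}.

(* The measure P is the joint law of the size and the strength of a layer.
   There is no instance when n < 2: a uniform ordered pair of distinct nodes
   does not exist.  The events {layer = g} range over a finite type, so the
   conditional laws are given by their point masses: [nodes_law] is the uniform
   distribution on the subsets of size z.1, and [edges_law] is the product of
   the Bernoulli(z.2.2) distributions over the pairs of nodes of the layer. *)
Record superposition_model (R : realType) (n m : nat)
    (P : probability (nat * R)%type R) := SuperpositionModel {
  sample_display : measure_display;
  sample : measurableType sample_display;
  prob : probability sample R;
  layer : 'I_m -> {RV prob >-> graph n};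
  size_of : 'I_m -> {RV prob >-> nat};
  strength : 'I_m -> {RV prob >-> R};
  node_pair : sample -> 'I_n * 'I_n;
  layers_independent :
    mutually_independent prob
      (fun k w => (layer k w, (size_of k w, strength k w)));
  layer_type_law : forall (k : 'I_m) (B : set (nat * R)), measurable B ->
    prob [set w | B (size_of k w, strength k w)] = P B;
  nodes_law : forall (k : 'I_m) (V : {set 'I_n}),
    conditional_probability prob [set w | nodes (layer k w) = V]
      (fun w => (size_of k w, strength k w))
      (fun z => (#|V| == z.1)%:R / 'C(n, z.1)%:R);
  edges_law : forall (k : 'I_m) (F : {set {set 'I_n}}),
    conditional_probability prob [set w | edges (layer k w) = F]
      (fun w => (nodes (layer k w), (size_of k w, strength k w)))
      (fun z => (F \subset node_pairs z.1)%:R *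
        \prod_(e in node_pairs z.1) (if e \in F then z.2.2 else 1 - z.2.2));
  node_pair_measurable : forall B : set ('I_n * 'I_n),
    measurable (node_pair @^-1` B);
  node_pair_uniform : forall i j : 'I_n,
    prob [set w | node_pair w = (i, j)] =
      ((i != j)%:R / (n * n.-1)%:R)%:E;
  node_pair_independent :
    forall (B : set ('I_n * 'I_n)) (C : set {set {set 'I_n}}),
    let E w := edges (superpose (fun k => layer k w)) in
    prob (node_pair @^-1` B `&` E @^-1` C) =
      (prob (node_pair @^-1` B) * prob (E @^-1` C))%E
}.

Arguments node_pair {R n m P} _ _.

Section assortativity.
Context (R : realType) (n m : nat) (P : probability (nat * R)%type R).
Variable M : superposition_model n m P.

Definition superposition_graph (w : sample M) : graph n :=
  superpose (fun k => layer M k w).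

Definition adjacent_event : set (sample M) :=
  [set w | [set (node_pair M w).1; (node_pair M w).2]%SET
             \in edges (superposition_graph w)].

Definition degI (w : sample M) : R :=
  (degree (superposition_graph w) (node_pair M w).1)%:R.

Definition degJ (w : sample M) : R :=
  (degree (superposition_graph w) (node_pair M w).2)%:R.

Definition model_assortativity : R :=
  let Estar := conditional_expectation (prob M) adjacent_event in
  (Estar (fun w => degI w * degJ w) - Estar degI ^+ 2) /
  (Estar (fun w => degI w ^+ 2) - Estar degI ^+ 2).

End assortativity.

(* Main.v *)
(** Write (n)_v for the falling factorial. A uniform X-subset of [n] contains v
    given nodes with probability (X)_v/(n)_v, so a layer contains a given set of
    s node pairs covering v nodes with probability P^(n)_{vs}/(n)_v. Since the
    layers are independent, inclusion-exclusion over the pairs that all m layers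
    miss gives the exact probability that G_n contains a given set of at most
    three pairs as a signed sum of powers (1 - u)^m with u = O(n^-2); expanding
    these powers to third order yields the limits of n P(12), n^2 P(12, 13),
    n^2 P(12, 13, 23), n^3 P(12, 13, 24) and n^3 P(12, 13, 14). The conditional
    moments of the degrees are linear in the ratios of these probabilities. The
    only moments not covered by the hypotheses are P_33, whose convergence
    follows from the uniform integrability of (X)_3 Y^2, and P_42, which enters
    through the path 12, 13, 24 and for which uniform integrability and X <= n
    give P^(n)_{42} = o(n). The limiting denominator is positive by
    Cauchy-Schwarz. *)
From HB Require Import structures.
Require Import Defs.
From mathcomp Require Import all_boot all_order all_algebra.
From mathcomp Require Import all_classical all_reals all_analysis.
From mathcomp Require Import measurable_realfun zify ring lra.
Import Order.TTheory GRing.Theory Num.Theory.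
Import numFieldNormedType.Exports.
Local Open Scope classical_set_scope.
Local Open Scope ring_scope.

Set Implicit Arguments.
Unset Strict Implicit.
Unset Printing Implicit Defensive.

(** * Integration against a density *)

(** Missing a set of pairs is an event that factors over the layers; containing it is not, because
    different pairs may come from different layers. Inclusion-exclusion is therefore used twice:
    inside a layer to pass from containing to missing, and for the superposition to pass back.

    Third order suffices because m u = O(1/n): the remainder is O(n^-4), while the rarest events
    that occur, path and star, have order n^-3. The lower orders cancel between the powers. This
    cancellation is a polynomial identity in m/n and 1/n, valid for each n, so the limits are
    evaluations at 1/n = 0.

    Squaring a degree produces stars; multiplying the degrees of both endpoints produces paths and
    triangles. Path and star differ only in that two pairs of the path are disjoint, which removes
    one P_32 term from the limit.

    The Bernoulli weights of the model are non-negative only for strengths in [0,1], so every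
    computation inside a layer is confined to the almost sure event that its type is admissible. *)

Section finite_content_measure.
Context d (T : measurableType d) (R : realType).
Variables (mu : {measure set T -> \bar R}) (mufin : fin_num_fun mu).

(** An alias that carries the proof of finiteness, so that canonical inference sees an arbitrary
    measure with finite values as a finite measure, which the Radon-Nikodym theorem asks for. *)
Definition fin_num_measure_of & fin_num_fun mu : set T -> \bar R := mu.

HB.instance Definition _ := Measure.on (fin_num_measure_of mufin).
HB.instance Definition _ :=
  Measure_isFinite.Build d T R (fin_num_measure_of mufin) mufin.

End finite_content_measure.

(** The density [h] and the Radon-Nikodym derivative have the same integral over every measurable
    set, so they agree almost everywhere, and the change of variables for the derivative applies. *)
Lemma ge0_integral_density d (T : measurableType d) (R : realType)
    (mu nu : {measure set T -> \bar R}) (h : T -> \bar R) :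
  fin_num_fun mu -> fin_num_fun nu ->
  measurable_fun setT h -> (forall x, 0 <= h x)%E ->
  (forall A, measurable A -> nu A = \int[mu]_(x in A) h x)%E ->
  forall g : T -> \bar R, measurable_fun setT g -> (forall x, 0 <= g x)%E ->
  (\int[nu]_x g x = \int[mu]_x (g x * h x))%E.
Proof.
move=> mufin nufin mh h0 nuE g mg g0.
pose fmu := fin_num_measure_of mufin; pose fnu := fin_num_measure_of nufin.
have numu : fnu `<< fmu.
  apply/null_content_dominatesP => A mA /= muA.
  rewrite -[LHS]/(nu A) nuE// (null_set_integral _ _ muA)//.
  exact: measurable_funTS.
rewrite -[LHS]/(\int[fnu]_x g x)%E -[RHS]/(\int[fmu]_x (g x * h x))%E.
rewrite -(Radon_Nikodym_SigmaFinite.change_of_variables numu g0)//.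
have intf := Radon_Nikodym_SigmaFinite.f_integrable numu.
apply: ae_eq_integral => //.
- by apply: emeasurable_funM => //; exact: measurable_int intf.
- exact: emeasurable_funM.
- apply: ae_eqe_mul2l; apply: integral_ae_eq => // E _ mE.
  by rewrite -Radon_Nikodym_SigmaFinite.f_integral// -nuE.
Qed.

Lemma ge0_integral_mrestr d (T : measurableType d) (R : realType)
    (mu : {finite_measure set T -> \bar R}) (D : set T) (mD : measurable D)
    (g : T -> \bar R) :
  measurable_fun setT g -> (forall x, 0 <= g x)%E ->
  (\int[mrestr mu mD]_x g x = \int[mu]_(x in D) g x)%E.
Proof.
move=> mg g0.
rewrite (@ge0_integral_density _ _ _ mu _ (EFin \o \1_D))//.
- rewrite [RHS]integral_mkcond; apply: eq_integral => x _.
  by rewrite epatch_indic.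
- exact/measurable_EFinP.
- by move=> x; rewrite lee_fin.
- by move=> A mA; rewrite integral_indic// setIC.
Qed.

Section conditional_probability.
Context {d d' : measure_display} {Omega : measurableType d}
  {S : measurableType d'} {R : realType}.
Variable Pr : probability Omega R.

(** The defining property of a conditional probability says that, on [S], the law of [W] restricted
    to [A] has density [f] with respect to the law of [W]. Pushing both measures forward reduces the
    claim to [ge0_integral_density]. *)
Lemma conditional_probability_integral (A : set Omega) (W : Omega -> S)
    (f : S -> R) (g : S -> \bar R) :
  measurable A -> measurable_fun setT W -> (forall z, 0 <= f z) ->
  conditional_probability Pr A W f ->
  measurable_fun setT g -> (forall z, 0 <= g z)%E ->
  (\int[Pr]_(w in A) g (W w) = \int[Pr]_w (g (W w) * (f (W w))%:E))%E.
Proof.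
move=> mA mW f0 [mf cpf] mg g0.
have WS B : measurable B -> measurable (W @^-1` B).
  by move=> mB; rewrite -[X in measurable X]setTI; exact: mW.
pose nu := measure_function_pushforward__canonical__measure_function_Measure
  (mrestr Pr mA) mW.
pose mu := measure_function_pushforward__canonical__measure_function_Measure
  Pr mW.
have mEf : measurable_fun setT (EFin \o f) by exact/measurable_EFinP.
have := @ge0_integral_density _ S _ mu nu (EFin \o f) _ _ mEf _ _ g mg g0.
rewrite !ge0_integral_pushforward//; first last.
- by move=> z _; rewrite mule_ge0 ?lee_fin.
- exact: emeasurable_funM.
rewrite ge0_integral_mrestr//=; last exact: measurableT_comp.
apply => //.
- by move=> B mB; exact: (fin_num_measure Pr _ (WS _ mB)).
- by move=> B mB; exact: (fin_num_measure (mrestr Pr mA) _ (WS _ mB)).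
- by move=> B mB; rewrite /mu /= ge0_integral_pushforward// ?[LHS]setIC;
    [rewrite -cpf//= /nu/= /pushforward /mrestr setIC|exact: measurable_funTS|
     move=> z _; rewrite lee_fin].
Qed.

End conditional_probability.

(** * Sums over subsets *)

Section subset_sums.
Context (R : comNzRingType) (T : finType).
Implicit Types A F J N : {set T}.

(** Expand a product of binomials: each [e] is put into [J] with weight [a e] or left out with
    weight [b e]. The zero of [b] on [F] forces F into J, the zero of [a] off [N] forces J into N,
    and each factor over N minus F is y + (1 - y) = 1. *)
Lemma sum_supersets_bernoulli N F (y : R) :
  \sum_(J : {set T} | F \subset J)
    (J \subset N)%:R * \prod_(e in N) (if e \in J then y else 1 - y) =
  (F \subset N)%:R * y ^+ #|F|.
Proof.
pose a e := (e \in N)%:R * y.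
pose b e := (e \notin F)%:R * (if e \in N then 1 - y else 1).
transitivity (\prod_e (a e + b e)).
  rewrite bigA_distr big_mkcond /=; apply: eq_bigr => J _.
  have [FJ|/subsetPn[e eF eJ]] := boolP (F \subset J); last first.
    by rewrite (bigD1 e)//= (negbTE eJ) /b eF !mul0r.
  have [JN|/subsetPn[e eJ eN]] := boolP (J \subset N); last first.
    by rewrite mul0r (bigD1 e)//= eJ /a (negbTE eN) !mul0r.
  rewrite mul1r big_mkcond; apply: eq_bigr => e _; rewrite /a /b.
  have [eJ|eJ] := boolP (e \in J).
    by rewrite (fintype.subsetP JN _ eJ) mul1r.
  by rewrite (contra (fintype.subsetP FJ e) eJ) mul1r.
have [FN|/subsetPn[e eF eN]] := boolP (F \subset N); last first.
  by rewrite (bigD1 e)//= /a /b (negbTE eN) eF !mul0r addr0 mul0r.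
rewrite mul1r -prodr_const [RHS]big_mkcond; apply: eq_bigr => e _.
rewrite /a /b; have [eF|eF] := boolP (e \in F).
  by rewrite (fintype.subsetP FN _ eF) mul0r addr0 mul1r.
by case: ifPn => _; rewrite ?mul1r ?mul0r ?add0r// addrC subrK.
Qed.

Lemma sum_sign_subsets A :
  \sum_(J : {set T} | J \subset A) (-1) ^+ #|J| = (A == finset.set0)%:R :> R.
Proof.
transitivity (\prod_(e : T) (- (e \in A)%:R + 1) : R).
  rewrite bigA_distr big_mkcond /=; apply: eq_bigr => J _; case: ifPn.
    move=> JA; rewrite -prodr_const big_mkcond; apply: eq_bigr => e _.
    by case: ifPn => // eJ; rewrite (fintype.subsetP JA _ eJ).
  by move=> /subsetPn[e eJ eA]; rewrite (bigD1 e)//= eJ (negbTE eA) oppr0 mul0r.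
have [->|[e eA]] := set_0Vmem A.
  by rewrite eqxx big1// => e _; rewrite inE oppr0 add0r.
rewrite (bigD1 e)//= eA addNr mul0r; case: eqP => // A0.
by move: eA; rewrite A0 inE.
Qed.

Lemma sum_subsetsU1 (x : T) A (f : {set T} -> R) : x \notin A ->
  \sum_(J : {set T} | J \subset (x |: A)%SET) f J =
  \sum_(J : {set T} | J \subset A) f J +
  \sum_(J : {set T} | J \subset A) f (x |: J)%SET.
Proof.
move=> xA; rewrite (bigID (fun J : {set T} => x \in J)) /= addrC; congr (_ + _).
  apply: eq_bigl => J; apply/andP/idP => [[JxA xJ]|JA].
    by apply/fintype.subsetP => y yJ; have := fintype.subsetP JxA _ yJ;
      rewrite !inE => /orP[/eqP yx|//]; rewrite yx (negbTE xJ) in yJ.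
  split; first by apply: fintype.subset_trans JA _; exact: finset.subsetUr.
  by apply: contra xA; exact: (fintype.subsetP JA).
rewrite (reindex_onto (fun J => x |: J)%SET (fun J => J :\ x)%SET) /=; last first.
  by move=> J /andP[_ xJ]; exact: finset.setD1K.
apply: eq_bigl => J; rewrite finset.setU11 andbT; apply/andP/idP => [[JA /eqP <-]|JA].
  apply/fintype.subsetP => y; rewrite !inE => /andP[yx /predU1P[|yJ]].
    by move/eqP; rewrite (negbTE yx).
  by have := fintype.subsetP JA y; rewrite !inE yJ (negbTE yx) orbT /=; exact.
split; first exact: finset.setUS.
by apply/eqP/finset.setU1K; apply: contra xA; exact: (fintype.subsetP JA).
Qed.

Lemma sum_subsets0 (f : {set T} -> R) :
  \sum_(J : {set T} | J \subset finset.set0) f J = f finset.set0.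
Proof. by rewrite (big_pred1 finset.set0)// => J; rewrite finset.subset0. Qed.

End subset_sums.

(** Removing [C] turns the supersets of size x into the subsets of size x - v of the complement,
    with v the size of [C]; their number is C(n - v, x - v). *)
Lemma sum_uniform_supersets (R : numFieldType) n (C : {set 'I_n}) (x : nat) :
  (x <= n)%N ->
  \sum_(V : {set 'I_n} | C \subset V) ((#|V| == x)%:R / 'C(n, x)%:R) =
  (x ^_ #|C|)%:R / (n ^_ #|C|)%:R :> R.
Proof.
move=> xn; have vn : (#|C| <= n)%N by rewrite -[leqRHS]card_ord max_card.
rewrite -mulr_suml -natr_sum.
have -> : (\sum_(V : {set 'I_n} | C \subset V) (#|V| == x) =
    if #|C| <= x then 'C(n - #|C|, x - #|C|) else 0)%N.
  case: ifPn => [vx|]; last first.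
    rewrite -ltnNge => xv; rewrite big1// => V /subset_leq_card CV.
    by rewrite gtn_eqF// (leq_trans xv).
  have -> : (n - #|C| = #|~: C|)%N.
    by rewrite [RHS]cardsCs finset.setCK card_ord.
  rewrite -cards_draws -sum1_card [RHS]big_mkcond.
  rewrite (reindex_onto (fun V => C :|: V)%SET (fun V => V :\: C)%SET) /=; last first.
    move=> V CV; apply/finset.setP => y; rewrite !inE.
    by case: (boolP (y \in C)) => // yC; rewrite (fintype.subsetP CV).
  rewrite big_mkcond; apply: eq_bigr => V _; rewrite inE finset.subsetUl /=.
  have -> : ((C :|: V) :\: C == V)%SET = (V \subset ~: C)%SET.
    rewrite finset.setDUl finset.setDv finset.set0U.
    by rewrite -finset.disjoints_subset; apply/eqP/idP => /finset.setDidPl.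
  case: ifPn => //=; rewrite -finset.disjoints_subset => dVC.
  rewrite cardsU finset.setIC (disjoint_setI0 dVC) cards0 subn0.
  by rewrite -{1}(subnKC vx) eqn_add2l; case: eqP.
have n0 : ('C(n, x))%:R != 0 :> R by rewrite pnatr_eq0 -lt0n bin_gt0.
have n1 : (n ^_ #|C|)%:R != 0 :> R by rewrite pnatr_eq0 -lt0n ffact_gt0.
apply/eqP; rewrite eqr_div// -!natrM eqr_nat; apply/eqP.
case: ifPn => [vx|]; last by rewrite -ltnNge => xv; rewrite mul0n (ffact_small xv).
(* After multiplication by (x - v)! (n - x)! both sides equal n!. *)
apply/eqP; rewrite -(eqn_pmul2r (fact_gt0 (x - #|C|))).
rewrite -(eqn_pmul2r (fact_gt0 (n - x))).
have -> : (x ^_ #|C| * 'C(n, x) * (x - #|C|)`! * (n - x)`! = n`!)%N.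
  by rewrite -(bin_fact xn) -(ffact_fact vx); nia.
have e : (n - x = n - #|C| - (x - #|C|))%N by rewrite subnBA// subnK.
rewrite -(ffact_fact vn) e -(bin_fact (leq_sub2r #|C| xn)).
by apply/eqP; nia.
Qed.

(** * The law of one layer *)

Lemma integral_full_set d (T : measurableType d) (R : realType)
    (P : probability T R) (A : set T) (f : T -> \bar R) :
  measurable A -> P A = 1%E -> measurable_fun setT f ->
  (\int[P]_x f x = \int[P]_(x in A) f x)%E.
Proof.
move=> mA PA mf; rewrite [RHS]integral_mkcond.
have PC : P (~` A) = 0%E by rewrite probability_setC// PA subee.
apply: ae_eq_integral => //.
  by apply/(measurable_restrictT _ mA); exact: measurable_funTS.
exists (~` A); split; [exact: measurableC|exact: PC|].
by apply: subsetC => z Az /= _; rewrite patchE mem_set.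
Qed.

Lemma measurable_cross_moment_fun (R : realType) r s :
  measurable_fun setT (fun z : nat * R => ((z.1 ^_ r)%:R * z.2 ^+ s : R)).
Proof.
apply: measurable_funM; last exact: measurable_funX.
exact: (measurableT_comp (_ : measurable_fun setT (fun x => (x ^_ r)%:R : R))).
Qed.

Lemma cross_momentE (R : realType) (P : probability (nat * R)%type R)
    (A : set (nat * R)) r s : measurable A -> P A = 1%E ->
  cross_moment P r s = (\int[P]_(z in A) ((z.1 ^_ r)%:R * z.2 ^+ s)%:E)%E.
Proof.
move=> mA PA; apply: (integral_full_set mA PA).
by apply/measurable_EFinP; exact: measurable_cross_moment_fun.
Qed.

Lemma measure_finite_valued d (Omega : measurableType d) (R : realType)
    (mu : {measure set Omega -> \bar R}) (T : finType) (X : Omega -> T)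
    (D : set Omega) (B : pred T) :
  (forall t, measurable (D `&` X @^-1` [set t])) ->
  mu (D `&` [set w | B (X w)]) = (\sum_(t | B t) mu (D `&` X @^-1` [set t]))%E.
Proof.
move=> mDX; rewrite -big_filter fsbig_seq ?filter_uniq ?index_enum_uniq//.
rewrite -measure_fin_bigcup//.
- congr (mu _); apply/seteqP; split=> [w [Dw Bw]|w [t /=]].
    by exists (X w) => //=; rewrite mem_filter Bw mem_index_enum.
  by rewrite mem_filter => /andP[Bt _] [Dw /= XwE]; rewrite XwE.
- apply/trivIsetP => s t _ _ /eqP st; apply/seteqP; split=> // w.
  by move=> [[_ /= ws] [_ /= wt]]; case: st; rewrite -ws -wt.
Qed.

Section layers.
Context (R : realType) (n m : nat) (P : probability (nat * R)%type R).
Variable M : superposition_model n m P.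
Hypothesis Pfin : P (finite_layer_types n) = 1%E.

Local Notation Pr := (prob M).
Local Notation type k := (fun w => (size_of M k w, strength M k w)).

Let measurable_type k : measurable_fun setT (type k).
Proof. exact: measurable_fun_pair. Qed.

Lemma measurable_finite_layer_types :
  measurable (@finite_layer_types R n).
Proof. by apply: measurableX => //; exact: measurable_itv. Qed.

Let mtypes k : measurable (type k @^-1` finite_layer_types n).
Proof.
rewrite -[X in measurable X]setTI; apply: measurable_type => //.
exact: measurable_finite_layer_types.
Qed.

Lemma type_finite_ae k (A : set (sample M)) : measurable A ->
  Pr A = Pr (A `&` type k @^-1` finite_layer_types n).
Proof.
move=> mA; rewrite -[in LHS](setIT A) -(setUv (type k @^-1` finite_layer_types n)).
rewrite setIUr measureU//; last 3 first.
- exact: measurableI.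
- by apply: measurableI => //; exact: measurableC.
- by rewrite setIACA setICr setI0.
rewrite [X in (_ + X)%E](_ : _ = 0%E) ?adde0//.
have mC : measurable (~` (type k @^-1` finite_layer_types n)).
  exact: measurableC.
have C0 : Pr (~` (type k @^-1` finite_layer_types n)) = 0%E.
  rewrite (probability_setC Pr (mtypes k)) [X in (_ - X)%E](_ : _ = 1%E) ?subee//.
  by rewrite -Pfin -(layer_type_law M k) //; exact: measurable_finite_layer_types.
apply: (subset_measure0 _ mC (@subIsetr _ A _) C0); exact: measurableI.
Qed.

Let measurable_layer_set k (B : set (graph n)) : measurable (layer M k @^-1` B).
Proof. exact: measurable_funPTI. Qed.

(** The event is split according to the exact edge set t containing [F]. The conditional weights are
    then summed under the integral sign, where [sum_supersets_bernoulli] collapses them. Restricting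
    to [D] keeps the strength in [0,1], hence the weights non-negative. *)
Lemma layer_contains_nodes k (V : {set 'I_n}) (F : {set {set 'I_n}}) :
  let D := [set w | nodes (layer M k w) = V] `&`
    type k @^-1` finite_layer_types n in
  Pr (D `&` [set w | F \subset edges (layer M k w)]) =
  (\int[Pr]_(w in D)
    ((F \subset node_pairs V)%:R * strength M k w ^+ #|F|)%:E)%E.
Proof.
move=> D.
have mD : measurable D.
  apply: measurableI => //.
  exact: (measurable_layer_set k [set g | nodes g = V]).
rewrite (@measure_finite_valued _ _ _ _ _ (fun w => edges (layer M k w)) D
  (fun t => F \subset t)); last first.
  by move=> t; apply: measurableI => //; exact: (measurable_layer_set k [set g | edges g = t]).
pose f (t : {set {set 'I_n}}) w : R := (t \subset node_pairs V)%:R *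
  \prod_(e in node_pairs V) (if e \in t then strength M k w else 1 - strength M k w).
have f0 t w : D w -> 0 <= f t w.
  move=> [_ [_ /=]]; rewrite in_itv/= => /andP[y0 y1].
  by apply: mulr_ge0 => //; apply: prodr_ge0 => e _; case: ifP => // _; lra.
have mf t : measurable_fun D (f t).
  apply: measurable_funM => //.
  under eq_fun do rewrite -big_enum.
  apply: measurable_prod => e _.
  by case: (e \in t); [|apply: measurable_funB => //]; exact: measurable_funTS.
have ft t : Pr (D `&` (fun w => edges (layer M k w)) @^-1` [set t]) =
    (\int[Pr]_(w in D) (f t w)%:E)%E.
  rewrite setIC; have [_] := edges_law M k t.
  move=> /(_ ([set V] `*` finite_layer_types n)).
  have -> : (fun w => (nodes (layer M k w), type k w)) @^-1`
    ([set V] `*` finite_layer_types n) = D by [].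
  move=> ->; last by apply: measurableX => //; exact: measurable_finite_layer_types.
  by apply: eq_integral => w; rewrite inE => -[/= -> _].
rewrite (eq_bigr _ (fun t _ => ft t)) -big_filter -ge0_integral_sum//.
- apply: eq_integral => w _; rewrite big_filter sumEFin; congr EFin.
  exact: sum_supersets_bernoulli.
- by move=> t; exact/measurable_EFinP.
Qed.

Lemma integral_strength_nodes k (V : {set 'I_n}) (s : nat) :
  (\int[Pr]_(w in [set w | nodes (layer M k w) = V] `&`
      type k @^-1` finite_layer_types n) (strength M k w ^+ s)%:E =
  \int[P]_(z in finite_layer_types n)
     ((#|V| == z.1)%:R / 'C(n, z.1)%:R * z.2 ^+ s)%:E)%E.
Proof.
(* The restriction on the type moves from the domain into the integrand: [g] is non-negative
   everywhere, as [conditional_probability_integral] requires. *)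
pose g (z : nat * R) : R := \1_(finite_layer_types n) z * z.2 ^+ s.
pose f (z : nat * R) : R := (#|V| == z.1)%:R / 'C(n, z.1)%:R.
have mFLT := measurable_finite_layer_types.
have g0 z : 0 <= g z.
  rewrite /g indicE; case: (boolP (z \in _)); last by rewrite mul0r.
  by rewrite inE => -[_ /=]; rewrite in_itv/= => /andP[? _]; rewrite mul1r exprn_ge0.
have f0 z : 0 <= f z by rewrite divr_ge0.
have mg : measurable_fun setT g.
  by apply: measurable_funM => //; exact: measurable_funX.
have mf := (nodes_law M k V).1.
transitivity (\int[Pr]_(w in [set w | nodes (layer M k w) = V])
    (EFin \o g) (type k w))%E.
  rewrite integral_mkcondr; apply: eq_integral => w _.
  rewrite /= /g indicE patchE.
  rewrite -[w \in _]/(type k w \in finite_layer_types n).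
  by case: ifP; rewrite ?mul1r ?mul0r.
rewrite (conditional_probability_integral _ _ _ (nodes_law M k V))//;
  first last.
- exact/measurable_EFinP.
- exact: (measurable_layer_set k [set g | nodes g = V]).
transitivity (\int[pushforward Pr (type k)]_z ((g z)%:E * (f z)%:E))%E.
  rewrite ge0_integral_pushforward//.
  - by apply: emeasurable_funM; exact/measurable_EFinP.
  - by move=> z _; rewrite mule_ge0// lee_fin.
rewrite (eq_measure_integral P)//; last by move=> A mA _; exact: layer_type_law.
rewrite [RHS]integral_mkcond; apply: eq_integral => z _.
rewrite patchE /g indicE -EFinM; case: ifPn => _; last by rewrite mul0r mul0r.
by rewrite mul1r mulrC.
Qed.

Lemma subset_node_pairs (F : {set {set 'I_n}}) (V : {set 'I_n}) :
  (forall e, e \in F -> #|e| = 2%N) ->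
  (F \subset node_pairs V) = (finset.cover F \subset V).
Proof.
move=> F2; apply/idP/finset.bigcupsP => [FV e eF|FV].
  by have := fintype.subsetP FV _ eF; rewrite inE => /andP[].
by apply/fintype.subsetP => e eF; rewrite inE FV//= F2.
Qed.

(** The event is split by the node set V. The sum over V is taken under the integral against [P],
    where the size is at most n and [sum_uniform_supersets] evaluates it. *)
Lemma prob_layer_contains k (F : {set {set 'I_n}}) :
  (forall e, e \in F -> #|e| = 2%N) ->
  Pr [set w | F \subset edges (layer M k w)] =
  (cross_moment P #|finset.cover F| #|F| * ((n ^_ #|finset.cover F|)%:R^-1)%:E)%E.
Proof.
move=> F2; set A := [set w | _].
have mA : measurable A := measurable_layer_set k [set g | F \subset edges g].
have mFLT := measurable_finite_layer_types.
set v := #|finset.cover F|; set s := #|F|.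
pose h (V : {set 'I_n}) (z : nat * R) : R := (#|V| == z.1)%:R / 'C(n, z.1)%:R * z.2 ^+ s.
have mh (V : {set 'I_n}) : measurable_fun (finite_layer_types n) (h V).
  apply: measurable_funTS; apply: measurable_funM; last exact: measurable_funX.
  exact: (nodes_law M k V).1.
have h0 (V : {set 'I_n}) z : finite_layer_types n z -> 0 <= h V z.
  move=> [_ /=]; rewrite in_itv /= => /andP[y0 _].
  by rewrite mulr_ge0 ?exprn_ge0// divr_ge0.
have AV (V : {set 'I_n}) : Pr ((A `&` type k @^-1` finite_layer_types n) `&`
    (fun w => nodes (layer M k w)) @^-1` [set V]) =
    (\int[P]_(z in finite_layer_types n) ((finset.cover F \subset V)%:R * h V z)%:E)%E.
  rewrite setIC (setIC A) setIA [LHS]layer_contains_nodes.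
  rewrite subset_node_pairs//; case: (finset.cover F \subset V).
    under eq_integral do rewrite mul1r.
    rewrite integral_strength_nodes.
    by apply: eq_integral => z _; rewrite mul1r.
  by rewrite !integral0_eq// => z _; rewrite mul0r.
have mAV (V : {set 'I_n}) : measurable ((A `&` type k @^-1` finite_layer_types n)
    `&` (fun w => nodes (layer M k w)) @^-1` [set V]).
  apply: measurableI; first exact: measurableI.
  exact: (measurable_layer_set k [set g | nodes g = V]).
have := measure_finite_valued Pr predT mAV.
have -> : [set w | predT (nodes (layer M k w))] = setT by apply/seteqP; split.
rewrite setIT (type_finite_ae k mA) => ->.
rewrite (eq_bigr _ (fun V _ => AV V)) -ge0_integral_sum//; first last.
- by move=> V z Fz; rewrite lee_fin mulr_ge0// h0.
- by move=> V; apply/measurable_EFinP/measurable_funM => //; exact: mh.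
rewrite (cross_momentE _ _ mFLT Pfin) -ge0_integralZr//;
  first last.
- move=> z [_ /=]; rewrite in_itv /= => /andP[y0 _].
  by rewrite lee_fin mulr_ge0 ?exprn_ge0.
- apply/measurable_EFinP/measurable_funTS; exact: measurable_cross_moment_fun.
apply: eq_integral => z; rewrite inE => -[/= zn _].
rewrite sumEFin -EFinM; congr EFin.
rewrite mulrAC -sum_uniform_supersets// mulr_suml [RHS]big_mkcond.
by apply: eq_bigr => V _; case: ifP; rewrite ?mul0r ?mul1r.
Qed.

End layers.

(** * The law of the superposition *)

Section random_sets.
Context d (Omega : measurableType d) (R : realType) (Pr : probability Omega R).
Context (T : finType).

Lemma fine_prob_finite_valued (X : Omega -> T) (B : pred T) :
  (forall t, measurable (X @^-1` [set t])) ->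
  fine (Pr [set w | B (X w)]) =
  \sum_t (B t)%:R * fine (Pr (X @^-1` [set t])).
Proof.
move=> mX.
have := @measure_finite_valued _ _ _ Pr _ X setT B.
under eq_bigr do rewrite setTI; rewrite setTI => ->; last first.
  by move=> t; rewrite setTI.
rewrite -sum_fine; last by move=> t _; exact: fin_num_measure.
by rewrite big_mkcond; apply: eq_bigr => t _; case: (B t); rewrite ?mul1r ?mul0r.
Qed.

End random_sets.

Section inclusion_exclusion.
Context d (Omega : measurableType d) (R : realType) (Pr : probability Omega R).
Context (T : finType).

(** For a fixed value A of [X], the sets J that contribute are the subsets of the intersection of S
    and A; their signs sum to 0 unless it is empty. *)
Lemma prob_disjoint_sum (X : Omega -> {set T}) (S : {set T}) :
  (forall A, measurable (X @^-1` [set A])) ->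
  fine (Pr [set w | [disjoint S & X w]%B]) =
  \sum_(J : {set T} | J \subset S) (-1) ^+ #|J| *
    fine (Pr [set w | J \subset X w]).
Proof.
move=> mX; rewrite (fine_prob_finite_valued Pr (fun A : {set T} => [disjoint S & A]%B))//.
under [RHS]eq_bigr => J _ do
  rewrite (fine_prob_finite_valued Pr (fun A : {set T} => J \subset A))// mulr_sumr.
rewrite exchange_big; apply: eq_bigr => A _ /=.
under eq_bigr do rewrite mulrA; rewrite -mulr_suml; congr (_ * _).
rewrite -setI_eq0 -sum_sign_subsets [LHS]big_mkcond [RHS]big_mkcond.
apply: eq_bigr => J _; rewrite finset.subsetI.
by case: (J \subset S) => //=; case: (J \subset A); rewrite ?mulr1 ?mulr0.
Qed.

(** This is [prob_disjoint_sum] for the complement of [X]. *)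
Lemma prob_subset_sum (X : Omega -> {set T}) (S : {set T}) :
  (forall A, measurable (X @^-1` [set A])) ->
  fine (Pr [set w | S \subset X w]) =
  \sum_(J : {set T} | J \subset S) (-1) ^+ #|J| *
    fine (Pr [set w | [disjoint J & X w]%B]).
Proof.
move=> mX.
have mXC (A : {set T}) : measurable ((fun w => ~: X w)%SET @^-1` [set A]).
  rewrite (_ : _ @^-1` _ = X @^-1` [set (~: A)%SET])//.
  by apply/seteqP; split=> w /= => [<-|->]; rewrite finset.setCK.
have := prob_disjoint_sum S mXC.
have -> : [set w | [disjoint S & (~: X w)%SET]%B] = [set w | S \subset X w].
  by apply/seteqP; split=> w /=; rewrite finset.disjoints_subset finset.setCK.
move=> ->; apply: eq_bigr => J _; congr (_ * fine (Pr _)).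
by apply/seteqP; split=> w /=; rewrite finset.disjoints_subset.
Qed.

End inclusion_exclusion.

Definition layer_contains_prob (R : realType) (P : probability (nat * R)%type R)
    n (v s : nat) : R :=
  fine (cross_moment P v s) / (n ^_ v)%:R.

Section superposition.
Context (R : realType) (n m : nat) (P : probability (nat * R)%type R).
Variable M : superposition_model n m P.
Hypothesis Pfin : P (finite_layer_types n) = 1%E.

Local Notation Pr := (prob M).
Local Notation q := (fun F : {set {set 'I_n}} =>
  layer_contains_prob P n #|finset.cover F| #|F|).

Lemma measurable_layer_edges k A :
  measurable ((fun w => edges (layer M k w)) @^-1` [set A]).
Proof. exact: (measurable_funPTI (layer M k) (Y := [set g | edges g = A])). Qed.

Lemma fine_prob_layer_contains k (F : {set {set 'I_n}}) :
  (forall e, e \in F -> #|e| = 2%N) ->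
  fine (Pr [set w | F \subset edges (layer M k w)]) = q F.
Proof.
move=> F2; rewrite prob_layer_contains// /layer_contains_prob.
(* The positive factor leaves an infinite moment infinite, and [fine] then makes both sides 0; no
   finiteness has to be shown here. *)
have c0 : 0 < (n ^_ #|finset.cover F|)%:R^-1 :> R.
  rewrite invr_gt0 ltr0n ffact_gt0.
  by rewrite (leq_trans (max_card _))// card_ord.
by case: cross_moment => [r| |] //=;
  rewrite ?mulyr ?mulNyr gtr0_sg ?mul1e ?mul0r.
Qed.

Lemma fine_prob_layer_misses k (F : {set {set 'I_n}}) :
  (forall e, e \in F -> #|e| = 2%N) ->
  fine (Pr [set w | [disjoint F & edges (layer M k w)]%B]) =
  \sum_(J : {set {set 'I_n}} | J \subset F) (-1) ^+ #|J| * q J.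
Proof.
move=> F2; rewrite prob_disjoint_sum; last exact: measurable_layer_edges.
apply: eq_bigr => J JF; rewrite fine_prob_layer_contains// => e eJ.
by apply: F2; exact: (fintype.subsetP JF).
Qed.

(** A union misses [F] exactly when each of its members does, which is an intersection of one event
    per layer. *)
Lemma prob_superposition_misses (F : {set {set 'I_n}}) :
  Pr [set w | [disjoint F & edges (superposition_graph w)]%B] =
  (\prod_k Pr [set w | [disjoint F & edges (layer M k w)]%B])%E.
Proof.
have := @layers_independent _ _ _ _ M
  (fun k => [set g : graph n | [disjoint F & edges g]%B] `*` setT).
rewrite (_ : \bigcap_k _ = [set w | [disjoint F & edges (superposition_graph w)]%B]).
  move=> ->; last by move=> k; exact: measurableX.
  by apply: eq_bigr => k _; congr (Pr _); apply/seteqP; split=> w //= [].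
apply/seteqP; split=> w /=.
  move=> Fw; rewrite finset.bigcup_disjoint// => k _.
  by have [] := Fw k I.
by move=> /finset.bigcup_disjointP Fw k _; split => //=; exact: Fw.
Qed.

Lemma measurable_superposition_edges A :
  measurable ((fun w : sample M => edges (superposition_graph w)) @^-1` [set A]).
Proof.
rewrite (_ : _ @^-1` _ = \bigcap_(e in [set: {set 'I_n}])
    [set w | (e \in edges (superposition_graph w)) = (e \in A)]).
  apply: fin_bigcap_measurable => // e _.
  have mE : measurable [set w : sample M | e \in edges (superposition_graph w)].
    rewrite (_ : mkset _ = \bigcup_(k in [set: 'I_m]) [set w | e \in edges (layer M k w)]).
      apply: fin_bigcup_measurable => // k _.
      exact: (measurable_funPTI (layer M k) (Y := [set g | e \in edges g])).
    apply/seteqP; split=> w /=; first by move=> /finset.bigcupP[k _ ek]; exists k.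
    by move=> [k _ ek]; apply/finset.bigcupP; exists k.
  case: (e \in A) => //; rewrite [X in measurable X](_ : _ =
      ~` [set w : sample M | e \in edges (superposition_graph w)]).
    exact: measurableC.
  by apply/seteqP; split=> w /= => [->|/negP/negbTE].
apply/seteqP; split=> w; first by move=> EA e _; rewrite /= -EA.
by move=> wA; apply/finset.setP => e; exact: wA.
Qed.

(** The outer signed sum is inclusion-exclusion for the superposition, the inner one for a single
    layer; the exponent comes from independence and from the common law of the layers. *)
Lemma prob_superposition_contains (F : {set {set 'I_n}}) :
  (forall e, e \in F -> #|e| = 2%N) ->
  fine (Pr [set w | F \subset edges (superposition_graph w)]) =
  \sum_(J : {set {set 'I_n}} | J \subset F) (-1) ^+ #|J| *
    (\sum_(I : {set {set 'I_n}} | I \subset J) (-1) ^+ #|I| * q I) ^+ m.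
Proof.
move=> F2; rewrite prob_subset_sum; last exact: measurable_superposition_edges.
apply: eq_bigr => J JF; congr (_ * _).
rewrite prob_superposition_misses -[in RHS](card_ord m) -prodr_const.
transitivity (fine (\prod_k (fine (Pr [set w | [disjoint J & edges (layer M k w)]%B]))%:E)).
  congr fine; apply: eq_bigr => k _; rewrite fineK//.
  by apply: fin_num_measure; exact: (measurable_funPTI (layer M k)
    (Y := [set g | [disjoint J & edges g]%B])).
rewrite prodEFin /=; apply: eq_bigr => k _.
rewrite fine_prob_layer_misses// => e eJ.
by apply: F2; exact: (fintype.subsetP JF).
Qed.

End superposition.

(** * Expectations over the random node pair as finite sums *)

Lemma fine_integral_finite_valued d (Omega : measurableType d) (R : realType)
    (Pr : probability Omega R) (T : finType) (X : Omega -> T) (B : pred T)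
    (F : T -> R) :
  (forall t, measurable (X @^-1` [set t])) -> (forall t, 0 <= F t) ->
  fine (\int[Pr]_(w in [set w | B (X w)]) (F (X w))%:E)%E =
  \sum_t (B t)%:R * F t * fine (Pr (X @^-1` [set t])).
Proof.
move=> mX F0.
pose h t w : \bar R := (((B t)%:R * F t)%:E * (\1_(X @^-1` [set t]) w)%:E)%E.
have -> : (\int[Pr]_(w in [set w | B (X w)]) (F (X w))%:E =
    \int[Pr]_w \sum_t h t w)%E.
  rewrite integral_mkcond; apply: eq_integral => w _.
  rewrite (bigD1 (X w))//= big1 ?adde0; last first.
    move=> t tX; rewrite /h indicE memNset ?mule0// => /= XwE.
    by move: tX; rewrite XwE eqxx.
  rewrite /h indicE mem_set// mule1 patchE.
  by case: ifPn => [/set_mem/= -> |/negP wB]; rewrite ?mul1r//;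
    case: (boolP (B (X w))) => [BX|_]; rewrite ?mul0r//; case: wB; rewrite inE.
rewrite ge0_integral_sum//.
- rewrite -sum_fine; last first.
    move=> t _; rewrite ge0_integralZl_EFin ?mulr_ge0//.
    + rewrite integral_indic// setIT fin_numM// fin_num_measure//.
    + exact/measurable_EFinP.
  apply: eq_bigr => t _; rewrite ge0_integralZl_EFin ?mulr_ge0//.
  + by rewrite integral_indic// setIT fineM// fin_num_measure.
  + exact/measurable_EFinP.
- by move=> t; apply: emeasurable_funM => //; exact/measurable_EFinP.
- by move=> t w _; rewrite mule_ge0 ?lee_fin// mulr_ge0.
Qed.

Section conditional_expectation_sums.
Context (R : realType) (n m : nat) (P : probability (nat * R)%type R).
Variable M : superposition_model n m P.

Local Notation Pr := (prob M).
Local Notation edge_set := (fun w : sample M => edges (superposition_graph w)).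

Definition contains_prob (F : {set {set 'I_n}}) : R :=
  fine (Pr [set w | F \subset edge_set w]).

(** The node pair and the edge set jointly take finitely many values, and by independence their
    point masses are products of a uniform weight on ordered pairs and a point mass of the edge
    set. *)
Lemma fine_integral_adjacent (f : 'I_n -> 'I_n -> {set {set 'I_n}} -> R) :
  (forall i j A, 0 <= f i j A) ->
  \int[Pr]_(w in @adjacent_event R n m P M)
    f (node_pair M w).1 (node_pair M w).2 (edge_set w) =
  (n * n.-1)%:R^-1 * \sum_i \sum_(j | i != j)
    \sum_(A : {set {set 'I_n}}) ([set i; j]%SET \in A)%:R * f i j A *
      fine (Pr (edge_set @^-1` [set A])).
Proof.
move=> f0.
pose X w := (node_pair M w, edge_set w).
pose B (t : 'I_n * 'I_n * {set {set 'I_n}}) := [set t.1.1; t.1.2]%SET \in t.2.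
have XE t : X @^-1` [set t] =
    node_pair M @^-1` [set t.1] `&` edge_set @^-1` [set t.2].
  by apply/seteqP; split=> w /=; case: t => a b /=; rewrite /X; [case=> <- <-|case=> <- <-].
have mX t : measurable (X @^-1` [set t]).
  rewrite XE; apply: measurableI; first exact: node_pair_measurable.
  exact: measurable_superposition_edges.
have := @fine_integral_finite_valued _ _ _ Pr _ X B (fun t => f t.1.1 t.1.2 t.2) mX
  (fun t => f0 _ _ _).
rewrite /Rintegral => ->.
transitivity (\sum_i \sum_j \sum_A (B ((i, j), A))%:R * f i j A *
    fine (Pr (X @^-1` [set ((i, j), A)]))).
  by rewrite !pair_bigA; apply: eq_bigr => -[[i j] A] _.
rewrite mulr_sumr; apply: eq_bigr => i _.
rewrite [in RHS]big_mkcond mulr_sumr; apply: eq_bigr => j _.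
have fp A : fine (Pr (X @^-1` [set ((i, j), A)])) =
    (i != j)%:R / (n * n.-1)%:R * fine (Pr (edge_set @^-1` [set A])).
  rewrite XE/= (node_pair_independent M [set (i, j)] [set A]) fineM//.
  - by rewrite [X in fine X * _](node_pair_uniform M i j).
  - by apply: fin_num_measure; exact: node_pair_measurable.
  - by apply: fin_num_measure; exact: measurable_superposition_edges.
under eq_bigr do rewrite fp.
case: (i != j); last first.
  by rewrite mulr0 big1// => A _; rewrite !mul0r mulr0.
rewrite mulr_sumr; apply: eq_bigr => A _; rewrite mul1r mulrCA; congr (_ * _).
Qed.

Lemma sum_contains_prob (F : {set {set 'I_n}}) :
  \sum_(A : {set {set 'I_n}}) (F \subset A)%:R * fine (Pr (edge_set @^-1` [set A]))
  = contains_prob F.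
Proof.
rewrite /contains_prob (fine_prob_finite_valued Pr
  (fun A : {set {set 'I_n}} => F \subset A))//.
exact: measurable_superposition_edges.
Qed.

End conditional_expectation_sums.

(** * Containment probabilities of one, two and three pairs *)

Section signed_subset_sums.
Context (R : comNzRingType) (T : finType) (f : {set T} -> R).
Implicit Types a b c : T.

Lemma sum_signed_subsets1 a :
  \sum_(J : {set T} | J \subset [set a]%SET) (-1) ^+ #|J| * f J =
  f finset.set0 - f [set a]%SET.
Proof.
rewrite -(finset.setU0 [set a]%SET) sum_subsetsU1 ?inE// !sum_subsets0.
by rewrite !finset.setU0 cards0 cards1; ring.
Qed.

Lemma sum_signed_subsetsU1 a (A : {set T}) : a \notin A ->
  \sum_(J : {set T} | J \subset (a |: A)%SET) (-1) ^+ #|J| * f J =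
  \sum_(J : {set T} | J \subset A) (-1) ^+ #|J| * f J -
  \sum_(J : {set T} | J \subset A) (-1) ^+ #|J| * f (a |: J)%SET.
Proof.
move=> aA; rewrite sum_subsetsU1//; congr (_ + _); rewrite -sumrN.
apply: eq_bigr => J JA; rewrite cardsU1 (contra (fintype.subsetP JA a) aA).
by rewrite exprS mulN1r mulNr.
Qed.

End signed_subset_sums.

Section signed_subset_sums23.
Context (R : comNzRingType) (T : finType) (f : {set T} -> R).
Implicit Types a b c : T.

Lemma sum_signed_subsets2 a b : a != b ->
  \sum_(J : {set T} | J \subset (a |: [set b])%SET) (-1) ^+ #|J| * f J =
  f finset.set0 - f [set a]%SET - f [set b]%SET + f (a |: [set b])%SET.
Proof.
move=> ab; rewrite sum_signed_subsetsU1 ?inE// sum_signed_subsets1.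
by rewrite (sum_signed_subsets1 (fun J => f (a |: J)%SET)) finset.setU0; ring.
Qed.

Lemma sum_signed_subsets3 a b c : a != b -> a != c -> b != c ->
  \sum_(J : {set T} | J \subset (a |: (b |: [set c]))%SET) (-1) ^+ #|J| * f J =
  f finset.set0 - f [set a]%SET - f [set b]%SET - f [set c]%SET
  + f (a |: [set b])%SET + f (a |: [set c])%SET + f (b |: [set c])%SET
  - f (a |: (b |: [set c]))%SET.
Proof.
move=> ab ac bc; rewrite sum_signed_subsetsU1 ?inE ?negb_or ?ab//.
rewrite !(sum_signed_subsetsU1 _ (a := b)) ?inE//.
rewrite (sum_signed_subsets1 f) (sum_signed_subsets1 (fun J => f (a |: J)%SET)).
rewrite (sum_signed_subsets1 (fun J => f (b |: J)%SET)).
rewrite (sum_signed_subsets1 (fun J => f (a |: (b |: J))%SET)).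
by rewrite !finset.setU0; ring.
Qed.

End signed_subset_sums23.

Section edge_shapes.
Context (n : nat).
Implicit Types i j k l : 'I_n.
Local Notation e i j := [set i; j]%SET.

Lemma edge_neq i j k l : k != i -> k != j -> e i j != e k l.
Proof.
move=> ki kj; apply/eqP => /finset.setP/(_ k).
by rewrite !inE eqxx (negbTE ki) (negbTE kj).
Qed.

Lemma card_edge i j : i != j -> #|e i j| = 2%N.
Proof. by rewrite cards2 => ->. Qed.

Lemma cover_edge1 (A : {set 'I_n}) : finset.cover [set A]%SET = A.
Proof. by rewrite /finset.cover big_set1. Qed.

Lemma cover_edgeU (A : {set 'I_n}) (F : {set {set 'I_n}}) :
  finset.cover (A |: F)%SET = (A :|: finset.cover F)%SET.
Proof. by rewrite /finset.cover finset.bigcup_setU big_set1. Qed.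

Lemma card_set_seq (A : {set 'I_n}) (s : seq 'I_n) :
  uniq s -> A =i s -> #|A| = size s.
Proof. by move=> us As; rewrite (eq_card As); exact/card_uniqP. Qed.

End edge_shapes.

Section contain_formulas.
Context {R : comNzRingType}.
Implicit Types (m : nat) (q x y z t : R).

(* The probability that m independent layers jointly contain one, two or three
   given pairs, where a single layer contains each pair with probability q, two
   of them with probability x (y, z) and all three with probability t. *)
Definition contains1 m q : R := 1 - (1 - q) ^+ m.

Definition contains2 m q x : R :=
  1 - (1 - q) ^+ m - (1 - q) ^+ m + (1 - q - q + x) ^+ m.

Definition contains3 m q x y z t : R :=
  1 - (1 - q) ^+ m - (1 - q) ^+ m - (1 - q) ^+ m
  + (1 - q - q + x) ^+ m + (1 - q - q + y) ^+ m + (1 - q - q + z) ^+ m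
  - (1 - q - q - q + x + y + z - t) ^+ m.

End contain_formulas.

Section contains_prob_shapes.
Context (R : realType) (n m : nat) (P : probability (nat * R)%type R).
Variable M : superposition_model n m P.
Hypothesis Pfin : P (finite_layer_types n) = 1%E.
Implicit Types i j k l : 'I_n.
Local Notation e i j := [set i; j]%SET.
Local Notation q := (layer_contains_prob P n).
Local Notation qF F := (layer_contains_prob P n #|finset.cover F| #|F|).

Lemma layer_contains_prob00 : q 0 0 = 1.
Proof.
rewrite /layer_contains_prob ffactn0 divr1 /cross_moment.
under eq_integral do rewrite ffactn0 expr0 mulr1.
by rewrite integral_cst// [X in (_ * X)%E](probability_setT P) mule1.
Qed.

Let qF0 : qF (finset.set0 : {set {set 'I_n}}) = 1.
Proof. by rewrite cards0 /finset.cover big_set0 cards0 layer_contains_prob00. Qed.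

Let qF1 i j : i != j -> qF [set e i j]%SET = q 2 1.
Proof. by move=> ij; rewrite cover_edge1 cards1 card_edge. Qed.

Lemma layer_contains_adjacent i j k : i != j -> i != k -> j != k ->
  qF (e i j |: [set e i k])%SET = q 3 2.
Proof.
move=> ij ik jk; rewrite cover_edgeU cover_edge1 cards2.
rewrite (_ : e i j != e i k); last first.
  by rewrite (finset.setUC [set i] [set k])%SET edge_neq// eq_sym.
rewrite (@card_set_seq _ _ [:: i; j; k])//=.
  by rewrite !inE !negb_or ij ik jk.
by move=> x; rewrite !inE; case: (x == i); case: (x == j); case: (x == k).
Qed.

Lemma layer_contains_disjoint i j k l :
  i != j -> i != k -> i != l -> j != k -> j != l -> k != l ->
  qF (e i j |: [set e k l])%SET = q 4 2.
Proof.
move=> ij ik il jk jl kl; rewrite cover_edgeU cover_edge1 cards2.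
rewrite edge_neq// 1?eq_sym//.
rewrite (@card_set_seq _ _ [:: i; j; k; l])//=.
  by rewrite !inE !negb_or ij ik il jk jl kl.
by move=> x; rewrite !inE; case: (x == i); case: (x == j); case: (x == k); case: (x == l).
Qed.

Lemma layer_contains_triangle i j k : i != j -> i != k -> j != k ->
  qF (e i j |: (e i k |: [set e j k]))%SET = q 3 3.
Proof.
move=> ij ik jk; rewrite !cover_edgeU cover_edge1 cardsU1 cards2 !inE negb_or.
have [ki kj] : k != i /\ k != j by split; rewrite eq_sym.
rewrite (_ : e i j != e i k); last first.
  by rewrite (finset.setUC [set i] [set k])%SET edge_neq.
rewrite (_ : e i j != e j k); last first.
  by rewrite (finset.setUC [set j] [set k])%SET edge_neq.
rewrite (_ : e i k != e j k); last by rewrite edge_neq 1?eq_sym.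
rewrite (@card_set_seq _ _ [:: i; j; k])//=.
  by rewrite !inE !negb_or ij ik jk.
by move=> x; rewrite !inE; case: (x == i); case: (x == j); case: (x == k).
Qed.

Lemma layer_contains_path i j k l :
  i != j -> i != k -> i != l -> j != k -> j != l -> k != l ->
  qF (e i j |: (e i k |: [set e j l]))%SET = q 4 3.
Proof.
move=> ij ik il jk jl kl; rewrite !cover_edgeU cover_edge1 cardsU1 cards2 !inE.
rewrite negb_or.
rewrite (_ : e i j != e i k); last first.
  by rewrite (finset.setUC [set i] [set k])%SET edge_neq// eq_sym.
rewrite (_ : e i j != e j l); last first.
  by rewrite (finset.setUC [set j] [set l])%SET edge_neq// eq_sym.
rewrite edge_neq// 1?eq_sym//.
rewrite (@card_set_seq _ _ [:: i; j; k; l])//=.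
  by rewrite !inE !negb_or ij ik il jk jl kl.
by move=> x; rewrite !inE; case: (x == i); case: (x == j); case: (x == k); case: (x == l).
Qed.

Lemma layer_contains_star i j k l :
  i != j -> i != k -> i != l -> j != k -> j != l -> k != l ->
  qF (e i j |: (e i k |: [set e i l]))%SET = q 4 3.
Proof.
move=> ij ik il jk jl kl; rewrite !cover_edgeU cover_edge1 cardsU1 cards2 !inE.
rewrite negb_or !(finset.setUC [set i])%SET.
rewrite (_ : e j i != e k i); last by rewrite edge_neq// eq_sym.
rewrite (_ : e j i != e l i); last by rewrite edge_neq// eq_sym.
rewrite (_ : e k i != e l i); last by rewrite edge_neq// eq_sym.
rewrite (@card_set_seq _ _ [:: i; j; k; l])//=.
  by rewrite !inE !negb_or ij ik il jk jl kl.
by move=> x; rewrite !inE; case: (x == i); case: (x == j); case: (x == k); case: (x == l).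
Qed.

Lemma contains_prob1 i j : i != j ->
  contains_prob M [set e i j]%SET = contains1 m (q 2 1).
Proof.
move=> ij; rewrite /contains_prob prob_superposition_contains//; last first.
  by move=> A; rewrite inE => /eqP ->; exact: card_edge.
rewrite sum_signed_subsets1 sum_subsets0 sum_signed_subsets1.
by rewrite !qF0 qF1// cards0 mul1r expr1n.
Qed.

Let signed0 : \sum_(I : {set {set 'I_n}} | I \subset finset.set0)
  (-1) ^+ #|I| * qF I = 1 :> R.
Proof. by rewrite sum_subsets0 qF0 cards0 mul1r. Qed.

Let signed1 i j : i != j -> \sum_(I : {set {set 'I_n}} | I \subset [set e i j]%SET)
  (-1) ^+ #|I| * qF I = 1 - q 2 1 :> R.
Proof. by move=> ij; rewrite sum_signed_subsets1 qF0 qF1. Qed.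

Lemma contains_prob2 i j k : i != j -> i != k -> j != k ->
  contains_prob M (e i j |: [set e i k])%SET = contains2 m (q 2 1) (q 3 2).
Proof.
move=> ij ik jk; rewrite /contains_prob prob_superposition_contains//; last first.
  by move=> A; rewrite !inE => /orP[] /eqP ->; exact: card_edge.
have ijk : e i j != e i k.
  by rewrite (finset.setUC [set i] [set k])%SET edge_neq// eq_sym.
rewrite sum_signed_subsets2// signed0 !signed1// sum_signed_subsets2//.
by rewrite qF0 !qF1// layer_contains_adjacent// expr1n.
Qed.

Lemma contains_prob3 i j k l u v :
  i != j -> k != l -> u != v ->
  e i j != e k l -> e i j != e u v -> e k l != e u v ->
  contains_prob M (e i j |: (e k l |: [set e u v]))%SET =
  contains3 m (q 2 1) (qF (e i j |: [set e k l])%SET)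
    (qF (e i j |: [set e u v])%SET) (qF (e k l |: [set e u v])%SET)
    (qF (e i j |: (e k l |: [set e u v]))%SET).
Proof.
move=> ij kl uv n1 n2 n3.
rewrite /contains_prob prob_superposition_contains//; last first.
  by move=> A; rewrite !inE => /or3P[] /eqP ->; exact: card_edge.
rewrite sum_signed_subsets3// signed0 !signed1// !sum_signed_subsets2//.
by rewrite sum_signed_subsets3// qF0 !qF1// expr1n.
Qed.

Lemma contains_prob_triangle i j k : i != j -> i != k -> j != k ->
  contains_prob M (e i j |: (e i k |: [set e j k]))%SET =
  contains3 m (q 2 1) (q 3 2) (q 3 2) (q 3 2) (q 3 3).
Proof.
move=> ij ik jk.
have [ji ki kj] : [/\ j != i, k != i & k != j] by split; rewrite eq_sym.
rewrite contains_prob3//.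
- rewrite layer_contains_triangle//; congr contains3.
  + exact: layer_contains_adjacent.
  + by rewrite (finset.setUC [set i] [set j])%SET; exact: layer_contains_adjacent.
  + rewrite (finset.setUC [set i])%SET (finset.setUC [set j])%SET.
    exact: layer_contains_adjacent.
- by rewrite (finset.setUC [set i] [set k])%SET edge_neq.
- by rewrite (finset.setUC [set j] [set k])%SET edge_neq.
- by rewrite edge_neq.
Qed.

(** Among the pairs of edges of the path, only ik and jl are disjoint. This is the only source of
    [q 4 2], and the only difference from the star: path and star both have three edges on four
    nodes. *)
Lemma contains_prob_path i j k l :
  i != j -> i != k -> i != l -> j != k -> j != l -> k != l ->
  contains_prob M (e i j |: (e i k |: [set e j l]))%SET =
  contains3 m (q 2 1) (q 3 2) (q 3 2) (q 4 2) (q 4 3).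
Proof.
move=> ij ik il jk jl kl.
have [ji ki kj] : [/\ j != i, k != i & k != j] by split; rewrite eq_sym.
have [li lj lk] : [/\ l != i, l != j & l != k] by split; rewrite eq_sym.
rewrite contains_prob3//.
- rewrite layer_contains_path//; congr contains3.
  + exact: layer_contains_adjacent.
  + by rewrite (finset.setUC [set i] [set j])%SET; exact: layer_contains_adjacent.
  + exact: layer_contains_disjoint.
- by rewrite (finset.setUC [set i] [set k])%SET edge_neq.
- by rewrite (finset.setUC [set j] [set l])%SET edge_neq.
- by rewrite edge_neq.
Qed.

Lemma contains_prob_star i j k l :
  i != j -> i != k -> i != l -> j != k -> j != l -> k != l ->
  contains_prob M (e i j |: (e i k |: [set e i l]))%SET =
  contains3 m (q 2 1) (q 3 2) (q 3 2) (q 3 2) (q 4 3).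
Proof.
move=> ij ik il jk jl kl.
have [ji ki kj] : [/\ j != i, k != i & k != j] by split; rewrite eq_sym.
have [li lj lk] : [/\ l != i, l != j & l != k] by split; rewrite eq_sym.
rewrite contains_prob3//.
- by rewrite layer_contains_star// !layer_contains_adjacent.
- by rewrite (finset.setUC [set i] [set k])%SET edge_neq.
- by rewrite (finset.setUC [set i] [set l])%SET edge_neq.
- by rewrite (finset.setUC [set i] [set l])%SET edge_neq.
Qed.

(** A loop is a singleton, while the edges of a graph have two elements. This disposes of the
    degenerate indices in the degree sums below. *)
Lemma contains_prob_loop i (F : {set {set 'I_n}}) :
  [set i; i]%SET \in F -> contains_prob M F = 0.
Proof.
move=> iF; rewrite /contains_prob (_ : mkset _ = set0) ?measure0//.
apply/seteqP; split=> // w /= /fintype.subsetP/(_ _ iF) /finset.bigcupP[k _].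
move=> /(fintype.subsetP (valP (layer M k w))); rewrite inE => /andP[_].
by rewrite finset.setUid cards1.
Qed.

(** The sum is the probability that one layer misses [F]; positivity of [m] provides such a layer.
    The bounds later place u in [0,1] when (1 - u)^m is expanded. *)
Lemma layer_misses_bounds (F : {set {set 'I_n}}) : (0 < m)%N ->
  (forall A, A \in F -> #|A| = 2%N) ->
  0 <= \sum_(J : {set {set 'I_n}} | J \subset F) (-1) ^+ #|J| * qF J <= 1.
Proof.
case: m M => // m' M' _ F2.
rewrite -(fine_prob_layer_misses M' Pfin ord0 F2).
have mF : measurable [set w | [disjoint F & edges (layer M' ord0 w)]%B].
  exact: (measurable_funPTI (layer M' ord0) (Y := [set g | [disjoint F & edges g]%B])).
by rewrite fine_ge0// -lee_fin fineK ?fin_num_measure// probability_le1.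
Qed.

End contains_prob_shapes.

(** * Conditional moments of the degrees *)

Section node_sums.
Context (R : comNzRingType) (n : nat).
Implicit Types (i j k : 'I_n) (h : 'I_n -> R).

Lemma sum_nodes2 i j h : i != j ->
  \sum_k h k = h i + h j + \sum_(k | (k != i) && (k != j)) h k.
Proof.
by move=> ij; rewrite (bigD1 i)//= (bigD1 j) 1?eq_sym//= addrA.
Qed.

Lemma sum_nodes3 i j k h : i != j -> i != k -> j != k ->
  \sum_l h l = h i + h j + h k +
    \sum_(l | [&& l != i, l != j & l != k]) h l.
Proof.
move=> ij ik jk; rewrite (sum_nodes2 _ ij) (bigD1 k)/=; last first.
  by rewrite !(eq_sym k) ik.
by rewrite addrA; congr (_ + _); apply: eq_bigl => l; rewrite andbA.
Qed.

Lemma card_nodes2 i j : i != j -> #|[pred k | (k != i) && (k != j)]| = n.-2.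
Proof.
move=> ij; have := cardsC [set i; j]%SET.
rewrite card_ord cards2 ij => /(congr1 (fun x => x.-2)) /= <-.
by apply: eq_card => k; rewrite !inE negb_or.
Qed.

Lemma card_nodes3 i j k : i != j -> i != k -> j != k ->
  #|[pred l | [&& l != i, l != j & l != k]]| = n.-2.-1.
Proof.
move=> ij ik jk; have := cardsC (i |: [set j; k])%SET.
rewrite card_ord cardsU1 cards2 !inE negb_or ij ik jk => /(congr1 (fun x => x.-2.-1)) /= <-.
by apply: eq_card => l; rewrite !inE !negb_or.
Qed.

Lemma sum_nodes2_cst i j h (c : R) : i != j ->
  (forall k, k != i -> k != j -> h k = c) ->
  \sum_k h k = h i + h j + n.-2%:R * c.
Proof.
move=> ij hc; rewrite (sum_nodes2 _ ij); congr (_ + _).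
rewrite -(card_nodes2 ij) mulr_natl -sumr_const.
by apply: eq_big => [k|k /andP[]]; [rewrite inE|exact: hc].
Qed.

Lemma sum_nodes3_cst i j k h (c : R) : i != j -> i != k -> j != k ->
  (forall l, l != i -> l != j -> l != k -> h l = c) ->
  \sum_l h l = h i + h j + h k + n.-2.-1%:R * c.
Proof.
move=> ij ik jk hc; rewrite (sum_nodes3 _ ij ik jk); congr (_ + _).
rewrite -(card_nodes3 ij ik jk) mulr_natl -sumr_const.
by apply: eq_big => [l|l /and3P[]]; [rewrite inE|exact: hc].
Qed.

End node_sums.

Section conditional_degree_moments.
Context (R : realType) (n m : nat) (P : probability (nat * R)%type R).
Variable M : superposition_model n m P.
Hypothesis Pfin : P (finite_layer_types n) = 1%E.
Hypothesis n_gt1 : (1 < n)%N.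
Implicit Types i j k l : 'I_n.

Local Notation e i j := [set i; j]%SET.
Local Notation q := (layer_contains_prob P n).
Local Notation Pr := (prob M).
Local Notation edge_set := (fun w : sample M => edges (superposition_graph w)).
Local Notation Q1 := (contains1 m (q 2 1)).
Local Notation Q2 := (contains2 m (q 2 1) (q 3 2)).
Local Notation Qtriangle := (contains3 m (q 2 1) (q 3 2) (q 3 2) (q 3 2) (q 3 3)).
Local Notation Qpath := (contains3 m (q 2 1) (q 3 2) (q 3 2) (q 4 2) (q 4 3)).
Local Notation Qstar := (contains3 m (q 2 1) (q 3 2) (q 3 2) (q 3 2) (q 4 3)).
Local Notation Estar := (conditional_expectation Pr (@adjacent_event R n m P M)).

Hypothesis Q1_neq0 : Q1 != 0.

Let p (A : {set {set 'I_n}}) : R := fine (Pr (edge_set @^-1` [set A])).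

Lemma measurable_adjacent_event : measurable (@adjacent_event R n m P M).
Proof.
rewrite (_ : @adjacent_event R n m P M = \bigcup_(t in
    [set t : 'I_n * 'I_n * {set {set 'I_n}} | e t.1.1 t.1.2 \in t.2])
    (node_pair M @^-1` [set t.1] `&` edge_set @^-1` [set t.2])).
  apply: fin_bigcup_measurable => [|t _]; first exact: finite_finset.
  apply: measurableI; first exact: node_pair_measurable.
  exact: measurable_superposition_edges.
apply/seteqP; split=> w /=; first by exists (node_pair M w, edge_set w).
by move=> [[ij A] /= ijA [wij wA]]; rewrite /adjacent_event /= wij wA.
Qed.

(** When the edge sum has the same value [c] for all pairs, averaging over the uniform pair leaves
    [c]. The case f = 1 gives the probability [Q1] of the conditioning event. *)
Lemma conditional_expectation_nodes
    (f : 'I_n -> 'I_n -> {set {set 'I_n}} -> R) (c : R) :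
  (forall i j A, 0 <= f i j A) ->
  (forall i j, i != j ->
    \sum_(A : {set {set 'I_n}}) (e i j \in A)%:R * f i j A * p A = c) ->
  Estar (fun w => f (node_pair M w).1 (node_pair M w).2 (edge_set w)) = c / Q1.
Proof.
move=> f0 fc; rewrite /conditional_expectation.
have sum_cst (x : R) : (n * n.-1)%:R^-1 * \sum_i \sum_(j : 'I_n | i != j) x = x.
  under eq_bigr => i _.
    rewrite sumr_const (_ : #|_| = n.-1); last first.
      by rewrite -[in RHS](card_ord n) -(cardC1 i); apply: eq_card => j;
        rewrite !inE eq_sym.
    over.
  rewrite sumr_const card_ord.
  rewrite -mulrnA -[X in _ * X]mulr_natl mulrA mulnC mulVf ?mul1r//.
  by rewrite pnatr_eq0 -lt0n muln_gt0; case: n n_gt1 => [//|[]].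
rewrite fine_integral_adjacent//.
under eq_bigr do under eq_bigr => j ij do rewrite fc//.
rewrite sum_cst; congr (_ / _).
have := @fine_integral_adjacent _ _ _ _ M (fun _ _ _ => 1) (fun _ _ _ => ler01).
rewrite Rintegral_cst ?mul1r//; last exact: measurable_adjacent_event.
move=> ->; rewrite -[RHS]sum_cst; congr (_ * _).
apply: eq_bigr => i _; apply: eq_bigr => j ij.
rewrite -(contains_prob1 M Pfin ij) -sum_contains_prob; apply: eq_bigr => A _.
by rewrite mulr1 finset.sub1set.
Qed.

Let deg (i : 'I_n) (A : {set {set 'I_n}}) : R := \sum_k (e i k \in A)%:R.

Let degE i w : (degree (superposition_graph w) i)%:R = deg i (edge_set w).
Proof.
rewrite /degree /deg -sum1_card natr_sum big_mkcond /=.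
by apply: eq_bigr => k _; rewrite inE; case: ifP.
Qed.

Let deg_ge0 i A : 0 <= deg i A.
Proof. by apply: sumr_ge0. Qed.

Let contains2E i j k l :
  \sum_(A : {set {set 'I_n}}) (e i j \in A)%:R * (e k l \in A)%:R * p A =
  contains_prob M (e i j |: [set e k l])%SET.
Proof.
rewrite -sum_contains_prob; apply: eq_bigr => A _.
by rewrite finset.subUset !finset.sub1set -natrM mulnb.
Qed.

Let contains3E i j k l i' j' :
  \sum_(A : {set {set 'I_n}})
    (e i j \in A)%:R * ((e k l \in A)%:R * (e i' j' \in A)%:R) * p A =
  contains_prob M (e i j |: (e k l |: [set e i' j']))%SET.
Proof.
rewrite -sum_contains_prob; apply: eq_bigr => A _.
by rewrite !finset.subUset !finset.sub1set -!natrM !mulnb.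
Qed.

Let contains_dup (A : {set 'I_n}) : (A |: [set A])%SET = [set A]%SET.
Proof. by rewrite finset.setUid. Qed.

(** The index k = i is a loop and contributes 0; k = j repeats the pair ij and contributes [Q1]. *)
Lemma sum_contains2 i j : i != j ->
  \sum_k contains_prob M (e i j |: [set e i k])%SET = Q1 + n.-2%:R * Q2.
Proof.
move=> ij; rewrite (sum_nodes2_cst (c := Q2) ij) => [|k ki kj].
  rewrite (@contains_prob_loop _ _ _ _ M i) ?add0r; last by rewrite !inE eqxx orbT.
  by rewrite finset.setUid contains_prob1.
by rewrite contains_prob2// 1?eq_sym.
Qed.

Lemma conditional_expectation_degI : Estar (@degI R n m P M) = 1 + n.-2%:R * (Q2 / Q1).
Proof.
have -> : @degI R n m P M = fun w => deg (node_pair M w).1 (edge_set w).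
  by apply/funext => w; exact: degE.
rewrite (@conditional_expectation_nodes (fun i _ A => deg i A) (Q1 + n.-2%:R * Q2))//.
  by rewrite mulrDl divff// mulrA.
move=> i j ij; rewrite -(sum_contains2 ij).
under eq_bigr do rewrite /deg mulr_sumr mulr_suml.
by rewrite exchange_big; apply: eq_bigr => k _; exact: contains2E.
Qed.

(** With k and l the two neighbours of i, the coefficient 3 collects the coincidences that leave two
    distinct pairs: k = j with l free, l = j with k free, and k = l. *)
Lemma conditional_expectation_degI2 : Estar (fun w => @degI R n m P M w ^+ 2) =
  1 + 3 * n.-2%:R * (Q2 / Q1) + n.-2%:R * n.-2.-1%:R * (Qstar / Q1).
Proof.
have -> : (fun w => @degI R n m P M w ^+ 2) =
    fun w => deg (node_pair M w).1 (edge_set w) ^+ 2.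
  by apply/funext => w; rewrite /degI degE.
rewrite (@conditional_expectation_nodes (fun i _ A => deg i A ^+ 2)
  (Q1 + 3 * n.-2%:R * Q2 + n.-2%:R * n.-2.-1%:R * Qstar)).
- by field.
- by move=> *; exact: sqr_ge0.
move=> i j ij.
transitivity (\sum_k \sum_l
    contains_prob M (e i j |: (e i k |: [set e i l]))%SET).
  under eq_bigr => A _.
    rewrite expr2 /deg big_distrlr mulr_sumr mulr_suml.
    under eq_bigr do rewrite mulr_sumr mulr_suml.
    over.
  rewrite exchange_big; apply: eq_bigr => k _.
  by rewrite exchange_big; apply: eq_bigr => l _; exact: contains3E.
rewrite (sum_nodes2_cst (c := Q2 + Q2 + n.-2.-1%:R * Qstar) ij).
- rewrite big1 ?add0r; last first.
    by move=> l _; rewrite (@contains_prob_loop _ _ _ _ M i)// !inE eqxx !orbT.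
  rewrite (eq_bigr (fun l => contains_prob M (e i j |: [set e i l])%SET)).
    by rewrite sum_contains2//; ring.
  by move=> l _; rewrite finset.setUA contains_dup.
move=> k ki kj; have ik : i != k by rewrite eq_sym.
have jk : j != k by rewrite eq_sym.
rewrite (sum_nodes3_cst (c := Qstar) ij ik jk).
- rewrite (@contains_prob_loop _ _ _ _ M i) ?add0r; last by rewrite !inE eqxx !orbT.
  rewrite contains_dup (finset.setUCA [set e i j] [set e i k])%SET contains_dup.
  by rewrite finset.setUC !contains_prob2.
by move=> l li lj lk; rewrite contains_prob_star// eq_sym.
Qed.

(** Here k is a neighbour of i and l a neighbour of j. Two distinct pairs remain when k = j or when
    l = i, whence the coefficient 2; k = l closes a triangle, and all four nodes distinct give a
    path. *)
Lemma conditional_expectation_degIJ :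
  Estar (fun w => @degI R n m P M w * @degJ R n m P M w) =
  1 + 2 * n.-2%:R * (Q2 / Q1) + n.-2%:R * (Qtriangle / Q1) +
    n.-2%:R * n.-2.-1%:R * (Qpath / Q1).
Proof.
have -> : (fun w => @degI R n m P M w * @degJ R n m P M w) =
    fun w => deg (node_pair M w).1 (edge_set w) * deg (node_pair M w).2 (edge_set w).
  by apply/funext => w; rewrite /degI /degJ !degE.
rewrite (@conditional_expectation_nodes (fun i j A => deg i A * deg j A)
  (Q1 + 2 * n.-2%:R * Q2 + n.-2%:R * Qtriangle + n.-2%:R * n.-2.-1%:R * Qpath)).
- by field.
- by move=> *; exact: mulr_ge0.
move=> i j ij; have ji : j != i by rewrite eq_sym.
transitivity (\sum_k \sum_l
    contains_prob M (e i j |: (e i k |: [set e j l]))%SET).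
  under eq_bigr => A _.
    rewrite /deg big_distrlr mulr_sumr mulr_suml.
    under eq_bigr do rewrite mulr_sumr mulr_suml.
    over.
  rewrite exchange_big; apply: eq_bigr => k _.
  by rewrite exchange_big; apply: eq_bigr => l _; exact: contains3E.
rewrite (sum_nodes2_cst (c := Q2 + Qtriangle + n.-2.-1%:R * Qpath) ij).
- rewrite big1 ?add0r; last first.
    by move=> l _; rewrite (@contains_prob_loop _ _ _ _ M i)// !inE eqxx !orbT.
  rewrite (eq_bigr (fun l => contains_prob M (e j i |: [set e j l])%SET)).
    by rewrite sum_contains2//; ring.
  by move=> l _; rewrite finset.setUA contains_dup (finset.setUC [set i] [set j])%SET.
move=> k ki kj; have ik : i != k by rewrite eq_sym.
have jk : j != k by rewrite eq_sym.
rewrite (sum_nodes3_cst (c := Qpath) ij ik jk).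
- rewrite [X in _ + X + _ + _](@contains_prob_loop _ _ _ _ M j); last first.
    by rewrite !inE eqxx !orbT.
  rewrite (finset.setUC [set j] [set i])%SET.
  rewrite (finset.setUCA [set e i j])%SET contains_dup finset.setUC.
  by rewrite contains_prob2// contains_prob_triangle// addr0.
by move=> l li lj lk; rewrite contains_prob_path// eq_sym.
Qed.

End conditional_degree_moments.

(** * Cubic expansion of (1 - u)^m *)

Section one_minus_power.
Context {R : realFieldType}.
Implicit Types (u : R) (m j : nat).

(** By Pascal's rule the error E(m, j) satisfies E(m+1, j+1) = E(m, j+1) - u E(m, j). Induction on j
    and m bounds it by (m u)^(j+1) + u (m u)^j = (m u)^j (m+1) u, which is at most ((m+1)
    u)^(j+1). *)
Lemma exp_one_minus_truncation u m j : 0 <= u <= 1 ->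
  `|(1 - u) ^+ m - \sum_(i < j) (-1) ^+ i * 'C(m, i)%:R * u ^+ i| <=
  (m%:R * u) ^+ j.
Proof.
move=> /andP[u0 u1]; elim: j m => [|j IHj] m.
  rewrite big_ord0 subr0 expr0 ger0_norm ?exprn_ge0 ?subr_ge0//.
  by rewrite exprn_ile1 ?subr_ge0// lerBlDr lerDl.
elim: m => [|m IHm].
  rewrite big_ord_recl big1 => [|i _]; last by rewrite bin0n mulr0 mul0r.
  by rewrite bin0 !expr0 !mulr1 addr0 subrr normr0 mul0r expr0n.
have -> : (1 - u) ^+ m.+1 - \sum_(i < j.+1) (-1) ^+ i * 'C(m.+1, i)%:R * u ^+ i =
  ((1 - u) ^+ m - \sum_(i < j.+1) (-1) ^+ i * 'C(m, i)%:R * u ^+ i) -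
  u * ((1 - u) ^+ m - \sum_(i < j) (-1) ^+ i * 'C(m, i)%:R * u ^+ i).
  rewrite exprS !big_ord_recl !bin0 mulrBr mulr_sumr.
  have -> : \sum_(i < j) (-1) ^+ bump 0 i * 'C(m.+1, bump 0 i)%:R * u ^+ bump 0 i =
    \sum_(i < j) (-1) ^+ bump 0 i * 'C(m, bump 0 i)%:R * u ^+ bump 0 i -
    \sum_(i < j) u * ((-1) ^+ i * 'C(m, i)%:R * u ^+ i).
    rewrite -sumrB; apply: eq_bigr => i _.
    by rewrite /bump /= add1n binS natrD !exprS; ring.
  by ring.
apply: le_trans (ler_normB _ _) _.
rewrite normrM (ger0_norm u0).
apply: le_trans (lerD IHm (ler_wpM2l u0 (IHj m))) _.
have -> : (m%:R * u) ^+ j.+1 + u * (m%:R * u) ^+ j = (m%:R * u) ^+ j * (m.+1%:R * u).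
  by rewrite exprS -natr1; ring.
rewrite exprS mulrC ler_wpM2l ?mulr_ge0// lerXn2r ?nnegrE ?mulr_ge0//.
by rewrite ler_wpM2r// ler_nat.
Qed.

(** The binomial coefficients are written as polynomials in a real [x], so that identities in the
    ratio m/n are within reach of [field]. *)
Definition exp_one_minus_cubic (x u : R) : R :=
  1 - x * u + x * (x - 1) / 2 * u ^+ 2 - x * (x - 1) * (x - 2) / 6 * u ^+ 3.

Lemma exp_one_minus_cubicP u m : 0 <= u <= 1 ->
  `|(1 - u) ^+ m - exp_one_minus_cubic m%:R u| <= (m%:R * u) ^+ 4.
Proof.
move=> /(exp_one_minus_truncation m 4); congr (`|_ - _| <= _).
rewrite !big_ord_recl big_ord0 /= /bump /= !add1n bin0 bin1.
have -> : 'C(m, 2)%:R = m%:R * (m%:R - 1) / 2 :> R.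
  apply: (@mulIf _ 2); first by rewrite pnatr_eq0.
  rewrite -natrM -[2%N in LHS]/(2`!) bin_ffact mulfVK ?pnatr_eq0//.
  case: m => [|m]; first by rewrite mul0r.
  by rewrite ffactSS ffactn1 natrM -natr1; ring.
have -> : 'C(m, 3)%:R = m%:R * (m%:R - 1) * (m%:R - 2) / 6 :> R.
  apply: (@mulIf _ 6); first by rewrite pnatr_eq0.
  rewrite -natrM -[6%N in LHS]/(3`!) bin_ffact mulfVK ?pnatr_eq0//.
  case: m => [|[|m]]; [by rewrite !mul0r|by rewrite subrr mulr0 mul0r|].
  by rewrite !ffactSS ffactn1 !natrM -!natr1; ring.
by rewrite /exp_one_minus_cubic !exprS expr0; ring.
Qed.

End one_minus_power.

(** * Convergence of the cross moments *)

Section truncated_moments.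
Context {R : realType}.
Implicit Types (Q : probability (nat * R)%type R) (c : nat -> R) (r s K : nat).

Definition moment_fun r s (z : nat * R) : R := (z.1 ^_ r)%:R * z.2 ^+ s.

Lemma measurable_layer_types : measurable (@layer_types R).
Proof. by apply: measurableX => //; exact: measurable_itv. Qed.

Lemma moment_fun_ge0 r s z : layer_types z -> 0 <= moment_fun r s z.
Proof.
by move=> [_ /=]; rewrite in_itv /= => /andP[y0 _]; rewrite mulr_ge0 ?exprn_ge0.
Qed.

Lemma measurable_weighted_moment c r s :
  measurable_fun setT (fun z : nat * R => c z.1 * moment_fun r s z).
Proof.
apply: measurable_funM; last exact: measurable_cross_moment_fun.
exact: (measurableT_comp (_ : measurable_fun setT c)).
Qed.

(** Since [nat] is discrete, every weight in the size is continuous, in particular a sharp cut-off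
    at K; truncated moments are thus admissible test functions. *)
Lemma continuous_weighted_moment c r s :
  continuous (fun z : nat * R => c z.1 * moment_fun r s z).
Proof.
have cc c' : continuous (fun z : nat * R => c' z.1 : R).
  move=> z; apply: (@continuous_comp _ _ _ fst c'); first exact: cvg_fst.
  move=> A cA; rewrite /= nbhs_principalE; apply/principal_filterP.
  exact: (nbhs_singleton cA).
rewrite /moment_fun => z; apply: cvgM; first exact: cc.
apply: cvgM; first exact: (cc (fun k => (k ^_ r)%:R) z).
apply: (@continuous_comp _ _ _ snd (fun y : R => y ^+ s)); first exact: cvg_snd.
exact: exprn_continuous.
Qed.

Lemma integrable_moment Q r s : Q layer_types = 1%E ->
  (cross_moment Q r s < +oo)%E ->
  Q.-integrable layer_types (EFin \o moment_fun r s).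
Proof.
move=> Q1 rs; apply/integrableP; split.
  apply/measurable_EFinP/measurable_funTS; exact: measurable_cross_moment_fun.
rewrite (eq_integral (EFin \o moment_fun r s)); last first.
  by move=> z; rewrite inE => Lz /=; rewrite ger0_norm// moment_fun_ge0.
by rewrite (cross_momentE _ _ measurable_layer_types Q1) in rs.
Qed.

Lemma integrable_weighted_moment Q c r s : Q layer_types = 1%E ->
  (forall k, 0 <= c k <= 1) -> (cross_moment Q r s < +oo)%E ->
  Q.-integrable layer_types (EFin \o fun z => c z.1 * moment_fun r s z).
Proof.
move=> Q1 c01 /(integrable_moment Q1); apply: le_integrable.
- exact: measurable_layer_types.
- by apply/measurable_EFinP/measurable_funTS; exact: measurable_weighted_moment.
move=> z Lz /=; have /andP[c0 c1] := c01 z.1.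
rewrite lee_fin normrM (ger0_norm c0) ler_piMl//.
Qed.

(** Cutting at size K separates a bounded part, governed by weak convergence, from a tail whose
    uniform smallness is uniform integrability. *)
Definition low_moment Q r s K : R :=
  \int[Q]_(z in layer_types) ((z.1 <= K)%N%:R * moment_fun r s z).

Definition high_moment Q r s K : R :=
  \int[Q]_(z in layer_types) ((K < z.1)%N%:R * moment_fun r s z).

Lemma momentE Q r s : Q layer_types = 1%E ->
  fine (cross_moment Q r s) = \int[Q]_(z in layer_types) moment_fun r s z.
Proof. by move=> Q1; rewrite (cross_momentE _ _ measurable_layer_types Q1). Qed.

Lemma low_high_moment Q r s K : Q layer_types = 1%E ->
  (cross_moment Q r s < +oo)%E ->
  fine (cross_moment Q r s) = low_moment Q r s K + high_moment Q r s K.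
Proof.
move=> Q1 rs; rewrite momentE// /low_moment /high_moment -RintegralD//.
- apply: eq_Rintegral => z _; rewrite ltnNge.
  by case: (z.1 <= K)%N; rewrite ?mul1r ?mul0r ?addr0 ?add0r.
- exact: measurable_layer_types.
- apply: (integrable_weighted_moment (c := fun k => (k <= K)%N%:R)) => // k.
  by case: (k <= K)%N; rewrite ?ler01 ?lexx.
- apply: (integrable_weighted_moment (c := fun k => (K < k)%N%:R)) => // k.
  by case: (K < k)%N; rewrite ?ler01 ?lexx.
Qed.

Lemma high_moment_ge0 Q r s K : 0 <= high_moment Q r s K.
Proof. by apply: Rintegral_ge0 => z Lz; rewrite mulr_ge0// moment_fun_ge0. Qed.

Lemma high_moment_le Q r s t K : Q layer_types = 1%E ->
  (cross_moment Q r s < +oo)%E -> (cross_moment Q r t < +oo)%E -> (s <= t)%N ->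
  high_moment Q r t K <= high_moment Q r s K.
Proof.
move=> Q1 rs rt st; apply: le_Rintegral.
- exact: measurable_layer_types.
- apply: (integrable_weighted_moment (c := fun k => (K < k)%N%:R)) => // k.
  by case: (K < k)%N; rewrite ?ler01 ?lexx.
- apply: (integrable_weighted_moment (c := fun k => (K < k)%N%:R)) => // k.
  by case: (K < k)%N; rewrite ?ler01 ?lexx.
move=> z [_ /=]; rewrite in_itv /= => /andP[y0 y1].
by rewrite !ler_wpM2l//; exact: ler_wiXn2l.
Qed.

Lemma low_moment_cvg Q r s : Q layer_types = 1%E ->
  (cross_moment Q r s < +oo)%E ->
  low_moment Q r s K @[K --> \oo] --> fine (cross_moment Q r s).
Proof.
move=> Q1 rs; pose g K z : \bar R := ((z.1 <= K)%N%:R * moment_fun r s z)%:E.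
have mL := measurable_layer_types.
have glim z : limn (g ^~ z) = (moment_fun r s z)%:E.
  apply: lim_near_cst => //; exists z.1 => // K /= zK.
  by rewrite /g zK mul1r.
have qE := cross_momentE r s mL Q1.
have q0 : (0 <= cross_moment Q r s)%E.
  by rewrite qE; apply: integral_ge0 => z Lz; rewrite lee_fin moment_fun_ge0.
apply: fine_cvg; rewrite fineK ?ge0_fin_numE// qE.
have -> : (\int[Q]_(z in layer_types) ((z.1 ^_ r)%:R * z.2 ^+ s)%:E =
    \int[Q]_(z in layer_types) limn (g ^~ z))%E.
  by apply: eq_integral => z _; rewrite glim.
apply: cvg_monotone_convergence => //.
- move=> K; apply/measurable_EFinP/measurable_funTS.
  exact (@measurable_weighted_moment (fun k => (k <= K)%N%:R) r s).
- by move=> K z Lz; rewrite lee_fin mulr_ge0 ?moment_fun_ge0.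
- move=> z Lz K K' KK'; rewrite lee_fin ler_wpM2r ?moment_fun_ge0// ler_nat.
  by case: (leqP z.1 K) => // /leq_trans ->.
Qed.

Lemma weakly_converges_low_moment (Pn : nat -> probability (nat * R)%type R) P r s K :
  weakly_converges Pn P ->
  low_moment (Pn n) r s K @[n --> \oo] --> low_moment P r s K.
Proof.
move=> PnP; apply: (PnP (fun z => (z.1 <= K)%N%:R * moment_fun r s z)).
  apply: continuous_subspaceT.
  exact (@continuous_weighted_moment (fun k => (k <= K)%N%:R) r s).
(* A crude bound: one summand is the falling factorial of the actual size, and the power of the
   strength is at most 1. *)
exists (\sum_(i < K.+1) i ^_ r)%N%:R; split => // B KB z [_ /=].
rewrite in_itv /= => /andP[y0 y1]; apply: le_trans (ltW KB).
rewrite normrM /moment_fun normrM !normr_nat (ger0_norm (exprn_ge0 s y0)).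
case: leqP => zK; last by rewrite mul0r.
rewrite mul1r -[leRHS]mulr1 ler_pM ?exprn_ge0 ?exprn_ile1// ler_nat.
by rewrite (bigD1 (Ordinal (zK : (z.1 < K.+1)%N)))//= leq_addr.
Qed.

End truncated_moments.

Section moment_limits.
Context {R : realType} (Pn : nat -> probability (nat * R)%type R)
  (P : probability (nat * R)%type R).
Hypothesis PnFin : forall n, Pn n (finite_layer_types n) = 1%E.
Hypothesis P1 : P layer_types = 1%E.
Hypothesis PnP : weakly_converges Pn P.

Lemma finite_layer_types_full n : Pn n layer_types = 1%E.
Proof.
apply/eqP; rewrite eq_le probability_le1/=; last exact: measurable_layer_types.
rewrite -(PnFin n) le_measure ?inE//.
- exact: measurable_finite_layer_types.
- exact: measurable_layer_types.
- by move=> z [].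
Qed.

Lemma cross_moment_finite n r s : (cross_moment (Pn n) r s < +oo)%E.
Proof.
have mF := @measurable_finite_layer_types R n.
rewrite (cross_momentE _ _ mF (PnFin n)).
apply: (@le_lt_trans _ _ (\int[Pn n]_(z in finite_layer_types n)
    ((\sum_(i < n.+1) i ^_ r)%N%:R)%:E)%E); last first.
  by rewrite integral_cst// [X in (_ * X)%E](PnFin n) mule1 ltry.
apply: ge0_le_integral => //.
- by move=> z [_ Lz]; rewrite lee_fin (@moment_fun_ge0 _ r s z).
- apply/measurable_EFinP/measurable_funTS; exact: measurable_cross_moment_fun.
move=> z [/= zn]; rewrite in_itv /= => /andP[y0 y1].
rewrite lee_fin -[leRHS]mulr1 ler_pM ?exprn_ge0 ?exprn_ile1// ler_nat.
by rewrite (bigD1 (Ordinal (zn : (z.1 < n.+1)%N)))//= leq_addr.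
Qed.

Lemma cross_moment_le r s t : (s <= t)%N ->
  (cross_moment P r t <= cross_moment P r s)%E.
Proof.
move=> st; have mL := @measurable_layer_types R.
rewrite !(cross_momentE _ _ mL P1); apply: ge0_le_integral => //.
- by move=> z Lz; rewrite lee_fin (@moment_fun_ge0 _ r t).
- by apply/measurable_EFinP/measurable_funTS; exact: measurable_cross_moment_fun.
- by apply/measurable_EFinP/measurable_funTS; exact: measurable_cross_moment_fun.
move=> z [_ /=]; rewrite in_itv /= => /andP[y0 y1].
by rewrite lee_fin ler_wpM2l//; exact: ler_wiXn2l.
Qed.

Lemma cross_moment_ge0 r s : (0 <= cross_moment P r s)%E.
Proof.
rewrite (cross_momentE _ _ measurable_layer_types P1).
by apply: integral_ge0 => z Lz; rewrite lee_fin (@moment_fun_ge0 _ r s).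
Qed.

(** K is chosen for the limit [P] alone. It then serves all large n, because the tail is the full
    moment minus the truncated one and both of these converge. *)
Lemma uniformly_small_high_moment r s : (cross_moment P r s < +oo)%E ->
  cross_moment (Pn n) r s @[n --> \oo] --> cross_moment P r s ->
  forall eps : R, 0 < eps -> exists K, high_moment P r s K < eps /\
    \forall n \near \oo, high_moment (Pn n) r s K < eps.
Proof.
move=> rs rs_cvg eps eps0.
have rs_fin : cross_moment P r s \is a fin_num.
  by rewrite ge0_fin_numE// cross_moment_ge0.
have [K PK] : exists K, high_moment P r s K < eps.
  have /cvgrPdist_lt/(_ _ eps0)[K _ KP] := low_moment_cvg P1 rs.
  exists K; have := KP K (leqnn K); rewrite /= (low_high_moment K P1 rs).
  by rewrite addrAC subrr add0r ger0_norm// high_moment_ge0.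
exists K; split=> //.
have : high_moment (Pn n) r s K @[n --> \oo] --> high_moment P r s K.
  rewrite (_ : high_moment P r s K = fine (cross_moment P r s) - low_moment P r s K); last first.
    by rewrite (low_high_moment K P1 rs) addrAC subrr add0r.
  rewrite (_ : (fun n => _) = fun n =>
      fine (cross_moment (Pn n) r s) - low_moment (Pn n) r s K); last first.
    apply/funext => n.
    rewrite (low_high_moment K (finite_layer_types_full n) (cross_moment_finite n r s)).
    by rewrite addrAC subrr add0r.
  apply: cvgB; last exact: weakly_converges_low_moment.
  by apply: fine_cvg; rewrite fineK.
by move=> /cvgr_lt; apply.
Qed.

(* Weak convergence and convergence of the moment (r, s) make the family
   (X)_r Y^s uniformly integrable; for t >= s the functions (X)_r Y^t are
   dominated by it. *)
Lemma dominated_cross_moment_cvg r s t : (cross_moment P r s < +oo)%E ->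
  cross_moment (Pn n) r s @[n --> \oo] --> cross_moment P r s -> (s <= t)%N ->
  fine (cross_moment (Pn n) r t) @[n --> \oo] --> fine (cross_moment P r t).
Proof.
move=> rs rs_cvg st.
have rt := le_lt_trans (cross_moment_le r st) rs.
apply/cvgrPdist_lt => eps eps0.
(* One third each for the tail of [P], the tail of [Pn n] and the difference of the truncated
   moments. *)
have eps3 : 0 < eps / 3 by rewrite divr_gt0.
have [K [PK PnK]] := uniformly_small_high_moment rs rs_cvg eps3.
have low_cvg := @weakly_converges_low_moment _ _ _ r t K PnP.
near=> n.
rewrite (low_high_moment K P1 rt).
rewrite (low_high_moment K (finite_layer_types_full n) (cross_moment_finite n r t)).
have h1 : high_moment P r t K < eps / 3.
  by apply: le_lt_trans PK; exact: high_moment_le.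
have h2 : high_moment (Pn n) r t K < eps / 3.
  apply: (@le_lt_trans _ _ (high_moment (Pn n) r s K)); last by near: n.
  by apply: high_moment_le => //; [exact: finite_layer_types_full|
    exact: cross_moment_finite|exact: cross_moment_finite].
have h3 : `|low_moment P r t K - low_moment (Pn n) r t K| < eps / 3.
  by near: n; exact: (cvgrPdist_lt _ _).1.
have h1' := high_moment_ge0 P r t K; have h2' := high_moment_ge0 (Pn n) r t K.
by move: h3; rewrite !ltr_norml; lra.
Unshelve. all: by end_near. Qed.

(** In (x)_(r+1) = (x)_r (x - r) the last factor is at most K when x <= K, and at most n
    otherwise. *)
Lemma cross_momentS_le n r s K :
  fine (cross_moment (Pn n) r.+1 s) <=
  K%:R * fine (cross_moment (Pn n) r s) + n%:R * high_moment (Pn n) r s K.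
Proof.
have mF := @measurable_finite_layer_types R n.
have Ln := finite_layer_types_full n.
have iF (c : nat -> R) r' : (forall k, 0 <= c k <= 1) -> (Pn n).-integrable (finite_layer_types n)
    (EFin \o fun z => c z.1 * moment_fun r' s z).
  move=> c01; apply: (integrableS measurable_layer_types) => //; first by move=> z [].
  exact: (integrable_weighted_moment Ln c01 (cross_moment_finite n r' s)).
have iF1 r' : (Pn n).-integrable (finite_layer_types n) (EFin \o moment_fun r' s).
  have := iF (fun=> 1) r'; under [X in EFin \o X]eq_fun do rewrite mul1r.
  by apply => k; rewrite ler01 lexx.
have iFK : (Pn n).-integrable (finite_layer_types n)
    (EFin \o fun z => (K < z.1)%N%:R * moment_fun r s z).
  by apply: (iF (fun k => (K < k)%N%:R)) => k; case: (K < k)%N; rewrite ?ler01 ?lexx.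
(* The pointwise comparison uses that sizes are at most n, so the integral moves to the smaller set,
   which also has full mass. *)
have -> : high_moment (Pn n) r s K =
    \int[Pn n]_(z in finite_layer_types n) ((K < z.1)%N%:R * moment_fun r s z).
  have mh : measurable_fun setT
      (fun z : nat * R => ((K < z.1)%N%:R * moment_fun r s z)%:E).
    apply/measurable_EFinP.
    exact (@measurable_weighted_moment _ (fun k => (K < k)%N%:R) r s).
  congr fine; rewrite -(integral_full_set measurable_layer_types Ln mh).
  exact: integral_full_set mh.
have mE r' : fine (cross_moment (Pn n) r' s) =
    \int[Pn n]_(z in finite_layer_types n) moment_fun r' s z.
  by rewrite (cross_momentE _ _ mF (PnFin n)).
have iA : (Pn n).-integrable (finite_layer_types n)
    (EFin \o fun z => K%:R * moment_fun r s z).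
  exact: (integrableZl mF K%:R (iF1 r)).
have iB : (Pn n).-integrable (finite_layer_types n)
    (EFin \o fun z => n%:R * ((K < z.1)%N%:R * moment_fun r s z)).
  exact: (integrableZl mF n%:R iFK).
rewrite !mE -(RintegralZl _ mF (iF1 r)) -(RintegralZl _ mF iFK) -RintegralD//.
- apply: le_Rintegral => //.
    exact: (integrableD mF iA iB).
  move=> z [/= zn]; rewrite in_itv /= => /andP[y0 y1].
  rewrite /moment_fun ffactnSr natrM mulrAC.
  set h := _ * z.2 ^+ s; have h0 : 0 <= h by rewrite mulr_ge0 ?exprn_ge0.
  have zr : (z.1 - r)%:R <= z.1%:R :> R by rewrite ler_nat leq_subr.
  apply: le_trans (ler_wpM2l h0 zr) _.
  have znR : z.1%:R <= n%:R :> R by rewrite ler_nat.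
  case: leqP => [zK|Kz].
    by rewrite mul0r mulr0 addr0 mulrC ler_wpM2r// ler_nat.
  rewrite mul1r mulrC; apply: (le_trans (ler_wpM2r h0 znR)).
  by rewrite lerDr mulr_ge0.
Qed.

(** Divide [cross_momentS_le] by n: for fixed K the first term vanishes, and the second becomes a
    tail that is uniformly small. The limit moment of order (r+1, s) may well be infinite. *)
Lemma cross_momentS_ratio_cvg0 r s : (cross_moment P r s < +oo)%E ->
  cross_moment (Pn n) r s @[n --> \oo] --> cross_moment P r s ->
  fine (cross_moment (Pn n) r.+1 s) / n%:R @[n --> \oo] --> (0 : R).
Proof.
move=> rs rs_cvg; apply/cvgrPdist_lt => eps eps0.
have eps2 : 0 < eps / 2 by rewrite divr_gt0.
have [K [_ PnK]] := uniformly_small_high_moment rs rs_cvg eps2.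
have m_cvg := dominated_cross_moment_cvg rs rs_cvg (leqnn s).
have inv_cvg : (n%:R^-1 : R) @[n --> \oo] --> (0 : R).
  apply/gtr0_cvgV0; last exact: cvgr_idn.
  by exists 1%N => // n /= n1; rewrite ltr0n.
have : (K%:R * fine (cross_moment (Pn n) r s)) * n%:R^-1 @[n --> \oo] --> (0 : R).
  by rewrite -(mulr0 (K%:R * fine (cross_moment P r s))); apply: cvgM => //;
    apply: cvgM => //; exact: cvg_cst.
move=> /cvgr_lt/(_ _ eps2) small.
near=> n.
have n0 : 0 < n%:R :> R by rewrite ltr0n; near: n; exact: nbhs_infty_gt.
have ge0 : 0 <= fine (cross_moment (Pn n) r.+1 s).
  rewrite (cross_momentE _ _ measurable_layer_types (finite_layer_types_full n)).
  by apply: Rintegral_ge0 => z Lz; exact: (@moment_fun_ge0 _ r.+1 s).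
rewrite sub0r normrN ger0_norm ?divr_ge0//.
have := cross_momentS_le n r s K.
rewrite -(ler_pM2r (_ : 0 < n%:R^-1)) ?invr_gt0// => /le_lt_trans; apply.
rewrite mulrDl (mulrAC n%:R) divff ?gt_eqF// mul1r.
have : high_moment (Pn n) r s K < eps / 2 by near: n.
have : K%:R * fine (cross_moment (Pn n) r s) * n%:R^-1 < eps / 2 by near: n.
by lra.
Unshelve. all: by end_near. Qed.

End moment_limits.

(** * Scaling limits *)

Section scaled_limits.
Context {R : realType}.
Implicit Types (rho iota a x y z t : R).

(* The limits below are read off polynomials in the variables
   rho = m / n, iota = 1 / n, a = n^2 q, x, y, z = n^3 x, n^3 y, n^3 z and
   t = n^4 t (n^3 t in scaled3_triangle), in which the negative powers of
   iota have cancelled. *)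
Definition scaled1 rho iota a : R :=
  rho * a - rho * (rho - iota) / 2 * (a * a * iota)
  + rho * (rho - iota) * (rho - 2 * iota) / 6 * (a * a * a * iota * iota).

Definition scaled2 rho iota a x : R :=
  rho * x + rho * (rho - iota) / 2 *
    ((2 * a - x * iota) * (2 * a - x * iota) - 2 * (a * a))
  + iota * (rho * (rho - iota) * (rho - 2 * iota) / 6 *
    (2 * (a * a * a) - (2 * a - x * iota) * (2 * a - x * iota) * (2 * a - x * iota))).

Definition scaled3 rho iota a x y z t : R :=
  rho * t
  + rho * (rho - iota) / 2 *
    (2 * a * (x + y + z)
     + iota * (x * x + y * y + z * z - (x + y + z) * (x + y + z) - 6 * a * t)
     + iota * iota * (2 * (x + y + z) * t) - iota * iota * iota * (t * t))
  + rho * (rho - iota) * (rho - 2 * iota) / 6 *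
    (3 * (a * a * a)
     - (2 * a - x * iota) * (2 * a - x * iota) * (2 * a - x * iota)
     - (2 * a - y * iota) * (2 * a - y * iota) * (2 * a - y * iota)
     - (2 * a - z * iota) * (2 * a - z * iota) * (2 * a - z * iota)
     + (3 * a - (x + y + z) * iota + t * iota * iota)
       * (3 * a - (x + y + z) * iota + t * iota * iota)
       * (3 * a - (x + y + z) * iota + t * iota * iota)).

Definition scaled3_triangle rho iota a x t : R :=
  rho * t
  + rho * (rho - iota) / 2 *
    (iota * (6 * a * x - 6 * a * t)
     + iota * iota * (3 * (x * x) - 9 * (x * x) - t * t + 6 * x * t))
  + iota * (rho * (rho - iota) * (rho - 2 * iota) / 6 *
    (3 * (a * a * a)
     - 3 * ((2 * a - x * iota) * (2 * a - x * iota) * (2 * a - x * iota))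
     + (3 * a - 3 * x * iota + t * iota)
       * (3 * a - 3 * x * iota + t * iota)
       * (3 * a - 3 * x * iota + t * iota))).

Local Notation B := exp_one_minus_cubic.

Lemma scaled1E (n m q : R) : n != 0 ->
  n * (1 - B m q) = scaled1 (m / n) n^-1 (n ^+ 2 * q).
Proof. by move=> n0; rewrite /B /scaled1; field. Qed.

Lemma scaled2E (n m q x : R) : n != 0 ->
  n ^+ 2 * (1 - B m q - B m q + B m (q + q - x)) =
  scaled2 (m / n) n^-1 (n ^+ 2 * q) (n ^+ 3 * x).
Proof. by move=> n0; rewrite /B /scaled2; field. Qed.

Lemma scaled3E (n m q x y z t : R) : n != 0 ->
  n ^+ 3 * (1 - B m q - B m q - B m q
    + B m (q + q - x) + B m (q + q - y) + B m (q + q - z)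
    - B m (q + q + q - x - y - z + t)) =
  scaled3 (m / n) n^-1 (n ^+ 2 * q) (n ^+ 3 * x) (n ^+ 3 * y) (n ^+ 3 * z)
    (n ^+ 4 * t).
Proof. by move=> n0; rewrite /B /scaled3; field. Qed.

Lemma scaled3_triangleE (n m q x t : R) : n != 0 ->
  n ^+ 2 * (1 - B m q - B m q - B m q
    + B m (q + q - x) + B m (q + q - x) + B m (q + q - x)
    - B m (q + q + q - x - x - x + t)) =
  scaled3_triangle (m / n) n^-1 (n ^+ 2 * q) (n ^+ 3 * x) (n ^+ 3 * t).
Proof. by move=> n0; rewrite /B /scaled3_triangle; field. Qed.

Section polynomial_limits.
Variables (rho iota a x y z t : nat -> R) (mu a' x' y' z' t' : R).
Hypotheses (rho_cvg : rho @ \oo --> mu) (iota_cvg : iota @ \oo --> (0 : R)).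
Hypotheses (a_cvg : a @ \oo --> a') (x_cvg : x @ \oo --> x')
  (y_cvg : y @ \oo --> y') (z_cvg : z @ \oo --> z') (t_cvg : t @ \oo --> t').

Let tends (f : nat -> R) (l : R) : Prop := f @ \oo --> l.

Let tendsD f g b c : tends f b -> tends g c -> tends (fun k => f k + g k) (b + c).
Proof. exact: cvgD. Qed.

Let tendsN f b : tends f b -> tends (fun k => - f k) (- b).
Proof. exact: cvgN. Qed.

Let tendsM f g b c : tends f b -> tends g c -> tends (fun k => f k * g k) (b * c).
Proof. exact: cvgM. Qed.

(* The recursion is driven by the shape of the limit alone; unification with
   the statements of cvgD and cvgM at every node is prohibitively slow. *)
Local Ltac tends_polynomial :=
  lazymatch goal with
  | |- tends _ (_ + _) => apply tendsD; tends_polynomial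
  | |- tends _ (- _) => apply tendsN; tends_polynomial
  | |- tends _ (_ * _) => apply tendsM; tends_polynomial
  | |- tends (fun=> ?c) _ => exact (cvg_cst c)
  | |- _ => assumption
  end.
Local Ltac polynomial_cvg :=
  match goal with |- ?f @ \oo --> ?l => change (tends f l); tends_polynomial end.

Lemma scaled1_cvg : scaled1 (rho n) (iota n) (a n) @[n --> \oo] --> mu * a'.
Proof.
rewrite (_ : mu * a' = scaled1 mu 0 a'); last by rewrite /scaled1; field.
by rewrite /scaled1; polynomial_cvg.
Qed.

Lemma scaled2_cvg : scaled2 (rho n) (iota n) (a n) (x n) @[n --> \oo] -->
  mu * x' + mu ^+ 2 * a' ^+ 2.
Proof.
have -> : mu * x' + mu ^+ 2 * a' ^+ 2 = scaled2 mu 0 a' x'.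
  by rewrite /scaled2; field.
by rewrite /scaled2; polynomial_cvg.
Qed.

Lemma scaled3_cvg :
  scaled3 (rho n) (iota n) (a n) (x n) (y n) (z n) (t n) @[n --> \oo] -->
  mu * t' + mu ^+ 2 * a' * (x' + y' + z') + mu ^+ 3 * a' ^+ 3.
Proof.
have -> : mu * t' + mu ^+ 2 * a' * (x' + y' + z') + mu ^+ 3 * a' ^+ 3 =
  scaled3 mu 0 a' x' y' z' t' by rewrite /scaled3; field.
by rewrite /scaled3; polynomial_cvg.
Qed.

Lemma scaled3_triangle_cvg :
  scaled3_triangle (rho n) (iota n) (a n) (x n) (t n) @[n --> \oo] --> mu * t'.
Proof.
rewrite (_ : mu * t' = scaled3_triangle mu 0 a' x' t'); last first.
  by rewrite /scaled3_triangle; field.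
by rewrite /scaled3_triangle; polynomial_cvg.
Qed.

End polynomial_limits.

End scaled_limits.

Section contains_limits.
Context {R : realType}.
Local Notation B := exp_one_minus_cubic.
Variables (m : nat -> nat) (nu : nat -> R) (mu : R).
Hypotheses (nu_gt0 : forall k, 0 < nu k) (nu_cvg : (nu k)^-1 @[k --> \oo] --> (0 : R)).
Hypothesis m_cvg : (m k)%:R / nu k @[k --> \oo] --> mu.

Definition cubic_remainder k (u : R) : R := (1 - u) ^+ m k - B (m k)%:R u.

(** The rescaled remainder is at most nu^3 (m u)^4 = (m / nu * nu^2 u)^4 / nu, a convergent quantity
    divided by nu. *)
Lemma cubic_remainder_cvg0 (u : nat -> R) (l : R) :
  (\forall k \near \oo, 0 <= u k <= 1) ->
  nu k ^+ 2 * u k @[k --> \oo] --> l ->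
  nu k ^+ 3 * cubic_remainder k (u k) @[k --> \oo] --> (0 : R).
Proof.
move=> u01 u_cvg.
have bound_cvg : (((m k)%:R / nu k * (nu k ^+ 2 * u k)) *
    ((m k)%:R / nu k * (nu k ^+ 2 * u k)) *
    ((m k)%:R / nu k * (nu k ^+ 2 * u k)) *
    ((m k)%:R / nu k * (nu k ^+ 2 * u k))) * (nu k)^-1 @[k --> \oo] --> (0 : R).
  rewrite -(mulr0 (mu * l * (mu * l) * (mu * l) * (mu * l))).
  by do !apply: cvgM => //; do !apply: cvgM.
apply/cvgr0Pnorm_lt => eps eps0.
move/cvgr0Pnorm_lt : bound_cvg => /(_ _ eps0).
apply: filterS2 u01 => k uk; apply: le_lt_trans.
have nu0 := nu_gt0 k.
apply: le_trans _ (ler_norm _).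
have nu3 : 0 <= nu k ^+ 3 by rewrite exprn_ge0// ltW.
rewrite normrM (ger0_norm nu3).
apply: le_trans (ler_wpM2l nu3 (exp_one_minus_cubicP (m k) uk)) _.
rewrite le_eqVlt; apply/orP; left; apply/eqP; field.
by rewrite gt_eqF.
Qed.

Let remainder_small (u : nat -> R) (l : R) :
  (\forall k \near \oo, 0 <= 1 - u k <= 1) ->
  nu k ^+ 2 * u k @[k --> \oo] --> l ->
  nu k ^+ 3 * cubic_remainder k (u k) @[k --> \oo] --> (0 : R).
Proof.
move=> u01; apply: cubic_remainder_cvg0.
by apply: filterS u01 => k; rewrite !(subr_ge0, lerBlDr, lerDl) => /andP[-> ->].
Qed.

Variables (q x y z t : nat -> R) (q' x' y' z' t' : R).
Hypothesis q_cvg : nu k ^+ 2 * q k @[k --> \oo] --> q'.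
Hypothesis x_cvg : nu k ^+ 3 * x k @[k --> \oo] --> x'.
Hypothesis y_cvg : nu k ^+ 3 * y k @[k --> \oo] --> y'.
Hypothesis z_cvg : nu k ^+ 3 * z k @[k --> \oo] --> z'.
Hypothesis q01 : \forall k \near \oo, 0 <= 1 - q k <= 1.
Hypothesis x01 : \forall k \near \oo, 0 <= 1 - q k - q k + x k <= 1.
Hypothesis y01 : \forall k \near \oo, 0 <= 1 - q k - q k + y k <= 1.
Hypothesis z01 : \forall k \near \oo, 0 <= 1 - q k - q k + z k <= 1.
Hypothesis t01 : \forall k \near \oo,
  0 <= 1 - q k - q k - q k + x k + y k + z k - t k <= 1.

Let lower_order (w : nat -> R) (w' : R) : nu k ^+ 3 * w k @[k --> \oo] --> w' ->
  nu k ^+ 2 * w k @[k --> \oo] --> (0 : R).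
Proof.
move=> w_cvg; rewrite -(mulr0 w').
rewrite (_ : (fun k => _) = fun k => nu k ^+ 3 * w k * (nu k)^-1).
  exact: cvgM.
by apply/funext => k; field; rewrite gt_eqF.
Qed.

Let remainder_q : nu k ^+ 3 * cubic_remainder k (q k) @[k --> \oo] --> (0 : R).
Proof. exact: remainder_small q_cvg. Qed.

Let remainder_pair (w : nat -> R) (w' : R) :
  (\forall k \near \oo, 0 <= 1 - q k - q k + w k <= 1) ->
  nu k ^+ 3 * w k @[k --> \oo] --> w' ->
  nu k ^+ 3 * cubic_remainder k (q k + q k - w k) @[k --> \oo] --> (0 : R).
Proof.
move=> w01 /lower_order w_cvg; apply: (@remainder_small _ (q' + q' - 0)).
  by apply: filterS w01 => k; rewrite opprB addrCA opprD [in X in X -> _]addrC !addrA.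
under eq_fun do rewrite !mulrDr mulrN.
by apply: cvgB => //; exact: cvgD.
Qed.

Let expE k u : (1 - u) ^+ m k = B (m k)%:R u + cubic_remainder k u.
Proof. by rewrite /cubic_remainder addrCA subrr addr0. Qed.

Let vanish (r : nat -> R) : r k @[k --> \oo] --> (0 : R) ->
  r k * (nu k)^-1 @[k --> \oo] --> (0 : R).
Proof. by move=> r0; rewrite -(mulr0 0); exact: cvgM. Qed.

Let zeroD (r s : nat -> R) : r @ \oo --> (0 : R) -> s @ \oo --> (0 : R) ->
  r k + s k @[k --> \oo] --> (0 : R).
Proof. by move=> r0 s0; rewrite -[X in _ --> X](addr0 0); exact: cvgD. Qed.

Let zeroB (r s : nat -> R) : r @ \oo --> (0 : R) -> s @ \oo --> (0 : R) ->
  r k - s k @[k --> \oo] --> (0 : R).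
Proof. by move=> r0 s0; rewrite -[X in _ --> X](subr0 0); exact: cvgB. Qed.

Lemma contains1_cvg :
  nu k * contains1 (m k) (q k) @[k --> \oo] --> mu * q'.
Proof.
rewrite -[mu * q']subr0.
rewrite (_ : (fun k => _) = fun k =>
    scaled1 ((m k)%:R / nu k) (nu k)^-1 (nu k ^+ 2 * q k) -
    nu k ^+ 3 * cubic_remainder k (q k) * (nu k)^-1 * (nu k)^-1).
  apply: cvgB; first exact: scaled1_cvg.
  by do 2 apply: vanish; exact: remainder_q.
apply/funext => k; have nu0 : nu k != 0 by rewrite gt_eqF.
by rewrite -scaled1E// /contains1 expE; field.
Qed.

(** The two terms of the limit stand for both pairs in one layer and for pairs in two different
    layers. *)
Lemma contains2_cvg :
  nu k ^+ 2 * contains2 (m k) (q k) (x k) @[k --> \oo] -->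
  mu * x' + mu ^+ 2 * q' ^+ 2.
Proof.
rewrite -[X in _ --> X]addr0.
rewrite (_ : (fun k => _) = fun k =>
    scaled2 ((m k)%:R / nu k) (nu k)^-1 (nu k ^+ 2 * q k) (nu k ^+ 3 * x k) +
    (nu k ^+ 3 * cubic_remainder k (q k + q k - x k)
     - nu k ^+ 3 * cubic_remainder k (q k)
     - nu k ^+ 3 * cubic_remainder k (q k)) * (nu k)^-1).
  apply: cvgD; first exact: scaled2_cvg.
  by apply: vanish; do 2 (apply: zeroB => //); exact: remainder_pair x_cvg.
apply/funext => k; have nu0 : nu k != 0 by rewrite gt_eqF.
rewrite -scaled2E// /contains2 (_ : 1 - q k - q k + x k = 1 - (q k + q k - x k)).
  by rewrite !expE; field.
by ring.
Qed.

Let pair_expE k w : (1 - q k - q k + w) ^+ m k =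
  B (m k)%:R (q k + q k - w) + cubic_remainder k (q k + q k - w).
Proof. by rewrite -expE; congr (_ ^+ _); ring. Qed.

Let triple_expE k : (1 - q k - q k - q k + x k + y k + z k - t k) ^+ m k =
  B (m k)%:R (q k + q k + q k - x k - y k - z k + t k) +
  cubic_remainder k (q k + q k + q k - x k - y k - z k + t k).
Proof. by rewrite -expE; congr (_ ^+ _); ring. Qed.

Let triple_remainder k := - nu k ^+ 3 * cubic_remainder k (q k)
  - nu k ^+ 3 * cubic_remainder k (q k) - nu k ^+ 3 * cubic_remainder k (q k)
  + nu k ^+ 3 * cubic_remainder k (q k + q k - x k)
  + nu k ^+ 3 * cubic_remainder k (q k + q k - y k)
  + nu k ^+ 3 * cubic_remainder k (q k + q k - z k)
  - nu k ^+ 3 * cubic_remainder k (q k + q k + q k - x k - y k - z k + t k).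

Let triple_remainder_cvg0 : nu k ^+ 2 * t k @[k --> \oo] --> (0 : R) ->
  triple_remainder @ \oo --> (0 : R).
Proof.
move=> t_cvg; apply: zeroB; last first.
  apply: (@remainder_small _ (q' + q' + q' - 0 - 0 - 0 + 0)).
    apply: filterS t01 => k.
    rewrite [X in _ -> 0 <= X <= 1](_ : _ =
      1 - q k - q k - q k + x k + y k + z k - t k)//.
    by ring.
  under eq_fun do rewrite !mulrDr !mulrN.
  apply: cvgD => //; apply: cvgB; last exact: lower_order z_cvg.
  apply: cvgB; last exact: lower_order y_cvg.
  apply: cvgB; last exact: lower_order x_cvg.
  by do 2 (apply: cvgD => //).
apply: zeroD; last exact: remainder_pair z_cvg.
apply: zeroD; last exact: remainder_pair y_cvg.
apply: zeroD; last exact: remainder_pair x_cvg.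
do 2 (apply: zeroB => //).
by under eq_fun do rewrite mulNr; rewrite -oppr0; apply: cvgN.
Qed.

(** The powers of [mu] count the layers involved: all three pairs in one, two pairs in one and the
    third in another, or three different layers. *)
Lemma contains3_cvg : nu k ^+ 4 * t k @[k --> \oo] --> t' ->
  nu k ^+ 3 * contains3 (m k) (q k) (x k) (y k) (z k) (t k) @[k --> \oo] -->
  mu * t' + mu ^+ 2 * q' * (x' + y' + z') + mu ^+ 3 * q' ^+ 3.
Proof.
move=> t_cvg; rewrite -[X in _ --> X]addr0.
rewrite (_ : (fun k => _) = fun k =>
    scaled3 ((m k)%:R / nu k) (nu k)^-1 (nu k ^+ 2 * q k) (nu k ^+ 3 * x k)
      (nu k ^+ 3 * y k) (nu k ^+ 3 * z k) (nu k ^+ 4 * t k) +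
    triple_remainder k).
  apply: cvgD; first exact: scaled3_cvg.
  apply: triple_remainder_cvg0; apply: (@lower_order _ 0).
  rewrite -(mulr0 t').
  rewrite (_ : (fun k => _) = fun k => nu k ^+ 4 * t k * (nu k)^-1).
    exact: cvgM.
  by apply/funext => k; field; rewrite gt_eqF.
apply/funext => k; have nu0 : nu k != 0 by rewrite gt_eqF.
by rewrite -scaled3E// /contains3 !pair_expE triple_expE expE /triple_remainder; ring.
Qed.

(** A triangle covers only three nodes, so one of the layers contains it with probability of order
    n^-2. Triangles spread over several layers have order n^-3 and vanish at this scale. *)
Lemma contains3_triangle_cvg : y = x -> z = x ->
  nu k ^+ 3 * t k @[k --> \oo] --> t' ->
  nu k ^+ 2 * contains3 (m k) (q k) (x k) (y k) (z k) (t k) @[k --> \oo] -->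
  mu * t'.
Proof.
move=> yx zx t_cvg; rewrite -[X in _ --> X]addr0.
rewrite (_ : (fun k => _) = fun k =>
    scaled3_triangle ((m k)%:R / nu k) (nu k)^-1 (nu k ^+ 2 * q k)
      (nu k ^+ 3 * x k) (nu k ^+ 3 * t k) +
    triple_remainder k * (nu k)^-1).
  apply: cvgD; first exact: (scaled3_triangle_cvg m_cvg nu_cvg q_cvg x_cvg t_cvg).
  by apply: vanish; apply: triple_remainder_cvg0; exact: lower_order t_cvg.
apply/funext => k; have nu0 : nu k != 0 by rewrite gt_eqF.
rewrite -scaled3_triangleE// /contains3 !pair_expE triple_expE expE.
by rewrite /triple_remainder yx zx; field.
Qed.

End contains_limits.

(** * Bounds on the probabilities that a layer misses a small set of pairs *)

Section misses_bounds_shapes.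
Context (R : realType) (n m : nat) (P : probability (nat * R)%type R).
Variable M : superposition_model n m P.
Hypothesis Pfin : P (finite_layer_types n) = 1%E.
Hypotheses (m_gt0 : (0 < m)%N) (n_gt3 : (3 < n)%N).
Local Notation q := (layer_contains_prob P n).
Local Notation e i j := [set i; j]%SET.
Local Notation qF F := (layer_contains_prob P n #|finset.cover F| #|F|).

(** Four concrete nodes realise each shape, so that the numerical expressions below are recognised
    as probabilities. *)
Let o0 : 'I_n := Ordinal (ltnW (ltnW (ltnW n_gt3))).
Let o1 : 'I_n := Ordinal (ltnW (ltnW n_gt3)).
Let o2 : 'I_n := Ordinal (ltnW n_gt3).
Let o3 : 'I_n := Ordinal n_gt3.

Let qF0 : qF (finset.set0 : {set {set 'I_n}}) = 1.
Proof. by rewrite cards0 /finset.cover big_set0 cards0 layer_contains_prob00. Qed.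

Let qF1 (i j : 'I_n) : i != j -> qF [set e i j]%SET = q 2 1.
Proof. by move=> ij; rewrite cover_edge1 cards1 card_edge. Qed.

Lemma misses1_bounds : 0 <= 1 - q 2 1 <= 1.
Proof.
have := layer_misses_bounds M Pfin (F := [set e o0 o1]%SET) m_gt0.
rewrite sum_signed_subsets1 qF0 qF1//; apply => A.
by rewrite inE => /eqP ->; exact: card_edge.
Qed.

Lemma misses_adjacent_bounds : 0 <= 1 - q 2 1 - q 2 1 + q 3 2 <= 1.
Proof.
have := layer_misses_bounds M Pfin (F := e o0 o1 |: [set e o0 o2])%SET m_gt0.
rewrite sum_signed_subsets2; last first.
  by rewrite (finset.setUC [set o0] [set o2])%SET edge_neq.
rewrite qF0 !qF1// layer_contains_adjacent//; apply => A.
by rewrite !inE => /orP[] /eqP ->; exact: card_edge.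
Qed.

Lemma misses_disjoint_bounds : 0 <= 1 - q 2 1 - q 2 1 + q 4 2 <= 1.
Proof.
have := layer_misses_bounds M Pfin (F := e o0 o1 |: [set e o2 o3])%SET m_gt0.
rewrite sum_signed_subsets2; last by rewrite edge_neq.
rewrite qF0 !qF1// layer_contains_disjoint//; apply => A.
by rewrite !inE => /orP[] /eqP ->; exact: card_edge.
Qed.

Lemma misses_triangle_bounds :
  0 <= 1 - q 2 1 - q 2 1 - q 2 1 + q 3 2 + q 3 2 + q 3 2 - q 3 3 <= 1.
Proof.
have := layer_misses_bounds M Pfin
  (F := e o0 o1 |: (e o0 o2 |: [set e o1 o2]))%SET m_gt0.
rewrite sum_signed_subsets3.
- rewrite qF0 !qF1// layer_contains_triangle// layer_contains_adjacent//.
  rewrite (finset.setUC [set o0] [set o1])%SET layer_contains_adjacent//.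
  rewrite (finset.setUC [set o0] [set o2])%SET.
  rewrite (finset.setUC [set o1] [set o2])%SET layer_contains_adjacent//.
  apply => A.
  by rewrite !inE => /or3P[] /eqP ->; exact: card_edge.
- by rewrite (finset.setUC [set o0] [set o2])%SET edge_neq.
- by rewrite (finset.setUC [set o1] [set o2])%SET edge_neq.
- by rewrite edge_neq.
Qed.

Lemma misses_path_bounds :
  0 <= 1 - q 2 1 - q 2 1 - q 2 1 + q 3 2 + q 3 2 + q 4 2 - q 4 3 <= 1.
Proof.
have := layer_misses_bounds M Pfin
  (F := e o0 o1 |: (e o0 o2 |: [set e o1 o3]))%SET m_gt0.
rewrite sum_signed_subsets3.
- rewrite qF0 !qF1// layer_contains_path// layer_contains_adjacent//.
  rewrite (finset.setUC [set o0] [set o1])%SET layer_contains_adjacent//.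
  rewrite layer_contains_disjoint//; apply => A.
  by rewrite !inE => /or3P[] /eqP ->; exact: card_edge.
- by rewrite (finset.setUC [set o0] [set o2])%SET edge_neq.
- by rewrite (finset.setUC [set o1] [set o3])%SET edge_neq.
- by rewrite edge_neq.
Qed.

Lemma misses_star_bounds :
  0 <= 1 - q 2 1 - q 2 1 - q 2 1 + q 3 2 + q 3 2 + q 3 2 - q 4 3 <= 1.
Proof.
have := layer_misses_bounds M Pfin
  (F := e o0 o1 |: (e o0 o2 |: [set e o0 o3]))%SET m_gt0.
rewrite sum_signed_subsets3.
- rewrite qF0 !qF1// layer_contains_star// !layer_contains_adjacent//.
  apply => A; rewrite !inE => /or3P[] /eqP ->; exact: card_edge.
- by rewrite (finset.setUC [set o0] [set o2])%SET edge_neq.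
- by rewrite (finset.setUC [set o0] [set o3])%SET edge_neq.
- by rewrite (finset.setUC [set o0] [set o3])%SET edge_neq.
Qed.

End misses_bounds_shapes.

(** * Falling factorials, Cauchy-Schwarz and the limit of the assortativity *)

Lemma ffact_ratio_cvg (R : realType) v :
  n%:R ^+ v / (n ^_ v)%:R @[n --> \oo] --> (1 : R).
Proof.
elim: v => [|v IHv].
  by under eq_fun do rewrite expr0 ffactn0 divr1; exact: cvg_cst.
have step : n%:R / (n - v)%:R @[n --> \oo] --> (1 + v%:R * 0 : R).
  (* Shifting by v removes the truncated subtraction: the ratio becomes (n + v) / n. *)
  rewrite -(cvg_shiftn v) /=.
  have inv_cvg : (n%:R^-1 : R) @[n --> \oo] --> (0 : R).
    apply/gtr0_cvgV0; last exact: cvgr_idn.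
    by exists 1%N => // n /= n1; rewrite ltr0n.
  have : 1 + v%:R * n%:R^-1 @[n --> \oo] --> (1 + v%:R * 0 : R).
    by apply: cvgD; [exact: cvg_cst|apply: cvgM => //; exact: cvg_cst].
  move=> h; apply: cvg_trans h; apply: near_eq_cvg; exists 1%N => // n /= n1.
  by rewrite addnK natrD mulrDl divff// pnatr_eq0 -lt0n.
move: step; rewrite mulr0 addr0 => step.
rewrite -[X in _ --> X]mulr1; rewrite (_ : (fun n => _) =
  fun n => n%:R ^+ v / (n ^_ v)%:R * (n%:R / (n - v)%:R)).
  exact: cvgM.
by apply/funext => n; rewrite ffactnSr natrM exprSr invfM mulrACA.
Qed.

(** Since (x)_4 + (x)_3 = (x)_2 (x - 2)^2 and (x)_3 = (x)_2 (x - 2), the three quantities are the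
    moments of orders 0, 1 and 2 of (X - 2) Y under the weight (X)_2 Y. *)
Lemma cross_moment_cauchy_schwarz (R : realType) (P : probability (nat * R)%type R) :
  P layer_types = 1%E ->
  (forall r s, (r, s) \in [:: (2, 1); (3, 2); (3, 3); (4, 3)]%N ->
    (cross_moment P r s < +oo)%E) ->
  0 < fine (cross_moment P 2 1) ->
  fine (cross_moment P 3 2) ^+ 2 <= fine (cross_moment P 2 1) *
    (fine (cross_moment P 4 3) + fine (cross_moment P 3 3)).
Proof.
move=> P1 fin p21.
have mL := @measurable_layer_types R.
have i21 := integrable_moment P1 (fin 2%N 1%N isT).
have i32 := integrable_moment P1 (fin 3%N 2%N isT).
have i33 := integrable_moment P1 (fin 3%N 3%N isT).
have i43 := integrable_moment P1 (fin 4%N 3%N isT).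
(* The mean of (X - 2) Y under that weight, which minimises the weighted integral of ((X - 2) Y -
   c)^2. *)
set c := fine (cross_moment P 3 2) / fine (cross_moment P 2 1).
have ic21 : P.-integrable layer_types (EFin \o fun z => c ^+ 2 * moment_fun 2 1 z).
  exact: (integrableZl mL (c ^+ 2) i21).
have ic32 : P.-integrable layer_types (EFin \o fun z => 2 * c * moment_fun 3 2 z).
  exact: (integrableZl mL (2 * c) i32).
have is43 : P.-integrable layer_types
    (EFin \o fun z => moment_fun 4 3 z + moment_fun 3 3 z).
  exact: (integrableD mL i43 i33).
have is21 : P.-integrable layer_types
    (EFin \o fun z => moment_fun 4 3 z + moment_fun 3 3 z + c ^+ 2 * moment_fun 2 1 z).
  exact: (integrableD mL is43 ic21).
have : \int[P]_(z in layer_types) (2 * c * moment_fun 3 2 z) <=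
    \int[P]_(z in layer_types)
      (moment_fun 4 3 z + moment_fun 3 3 z + c ^+ 2 * moment_fun 2 1 z).
  apply: le_Rintegral => // -[x y] [_ /=]; rewrite in_itv /= => /andP[y0 y1].
  rewrite /moment_fun /= expr1 -subr_ge0.
  have e4 : (x ^_ 4)%:R + (x ^_ 3)%:R = (x ^_ 3)%:R * (x - 2)%:R :> R.
    rewrite -natrD -natrM; congr _%:R.
    have [x3|x3] := ltnP x 3; first by rewrite !ffact_small// ltnW.
    by rewrite (ffactnSr x 3) addnC -mulnS -subSn.
  have e3 : (x ^_ 3)%:R = (x ^_ 2)%:R * (x - 2)%:R :> R by rewrite -natrM -ffactnSr.
  rewrite -mulrDl e4 e3.
  (* The difference integrates to P_43 + P_33 - P_32^2 / P_21. *)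
  rewrite (_ : _ - _ = (x ^_ 2)%:R * y * ((x - 2)%:R * y - c) ^+ 2); last by ring.
  by rewrite mulr_ge0 ?sqr_ge0// mulr_ge0.
rewrite (RintegralZl _ mL i32) (RintegralD mL is43 ic21) (RintegralD mL i43 i33).
rewrite (RintegralZl _ mL i21) -!momentE//.
have key (a b d f : R) : 0 < a ->
    2 * (b / a) * b <= d + f + (b / a) ^+ 2 * a -> b ^+ 2 <= a * (d + f).
  move=> a0; have a_neq0 : a != 0 by rewrite gt_eqF.
  have -> : 2 * (b / a) * b = 2 * (b ^+ 2 / a) by field.
  have -> : (b / a) ^+ 2 * a = b ^+ 2 / a by field.
  by move=> le; rewrite mulrC -ler_pdivrMr//; lra.
exact: key.
Qed.

Theorem theorem3 (R : realType) (m : nat -> nat) (mu : R)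
    (Pn : nat -> probability (nat * R)%type R)
    (P : probability (nat * R)%type R)
    (M : forall n : nat, superposition_model n.+2 (m n.+2) (Pn n.+2)) :
  (forall n : nat, Pn n (finite_layer_types n) = 1%E) ->
  P layer_types = 1%E ->
  m n @[n --> \oo] --> \oo ->
  0 < mu ->
  (m n)%:R / n%:R @[n --> \oo] --> mu ->
  weakly_converges Pn P ->
  (forall r s : nat,
     (r, s) \in [:: (1, 0); (2, 1); (3, 2); (4, 3)]%N ->
     (cross_moment P r s < +oo)%E /\
     cross_moment (Pn n) r s @[n --> \oo] --> cross_moment P r s) ->
  (0 < cross_moment P 1 0)%E ->
  (0 < cross_moment P 2 1)%E ->
  let p r s : R := fine (cross_moment P r s) in
  model_assortativity (M n) @[n --> \oo] -->
    (p 2%N 1%N * (p 4%N 3%N + p 3%N 3%N) - p 3%N 2%N ^+ 2) /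
    (p 2%N 1%N * (p 4%N 3%N + p 3%N 2%N) - p 3%N 2%N ^+ 2
      + mu * p 2%N 1%N ^+ 2 * (p 2%N 1%N + p 3%N 2%N)).
Proof.
move=> PnFin P1 m_cvg mu_gt0 mn_cvg PnP moments _ p21_gt0 p.
have [fin21 cvg21] := moments 2%N 1%N isT.
have [fin32 cvg32] := moments 3%N 2%N isT.
have [fin43 cvg43] := moments 4%N 3%N isT.
have a_gt0 : 0 < p 2%N 1%N by rewrite fine_gt0// p21_gt0.
have fin33 : (cross_moment P 3 3 < +oo)%E.
  exact: le_lt_trans (cross_moment_le P1 3 (leqnSn 2)) fin32.
have p32_ge0 : 0 <= p 3%N 2%N by rewrite fine_ge0// cross_moment_ge0.
have p33_le : p 3%N 3%N <= p 3%N 2%N.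
  rewrite fine_le ?ge0_fin_numE ?cross_moment_ge0//.
  exact: cross_moment_le.
have cs : p 3%N 2%N ^+ 2 <= p 2%N 1%N * (p 4%N 3%N + p 3%N 3%N).
  apply: cross_moment_cauchy_schwarz => // r s.
  by rewrite !inE => /or4P[] /eqP[-> ->].
(* The model with index k has k + 2 nodes, so this is the number of nodes, by which everything is
   rescaled. *)
pose nu k : R := k.+2%:R.
pose q v s k := layer_contains_prob (Pn k.+2) k.+2 v s.
have shift (f : nat -> R) (l : R) : f @ \oo --> l -> f k.+2 @[k --> \oo] --> l.
  by rewrite -(cvg_shiftn 2); under eq_fun do rewrite addn2.
have nu_gt0 k : 0 < nu k by rewrite ltr0n.
have inv_cvg : (n%:R^-1 : R) @[n --> \oo] --> (0 : R).
  apply/gtr0_cvgV0; last exact: cvgr_idn.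
  by exists 1%N => // n /= n1; rewrite ltr0n.
have nu_cvg := shift _ _ inv_cvg.
have mnu_cvg := shift _ _ mn_cvg.
have q_cvg v s l : fine (cross_moment (Pn n) v s) @[n --> \oo] --> (l : R) ->
    nu k ^+ v * q v s k @[k --> \oo] --> l.
  move=> vs_cvg; rewrite -[l]mulr1.
  rewrite (_ : (fun k => _) = fun k => fine (cross_moment (Pn k.+2) v s) *
      (k.+2%:R ^+ v / (k.+2 ^_ v)%:R)).
    exact: shift _ _ (cvgM vs_cvg (@ffact_ratio_cvg R v)).
  by apply/funext => k; rewrite /q /layer_contains_prob mulrCA.
have Q_cvg r s : (cross_moment P r s < +oo)%E ->
    cross_moment (Pn n) r s @[n --> \oo] --> cross_moment P r s ->
    nu k ^+ r * q r s k @[k --> \oo] --> p r s.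
  move=> fin rs_cvg; apply: q_cvg.
  exact: (dominated_cross_moment_cvg PnFin P1 PnP fin rs_cvg (leqnn s)).
have q21 := Q_cvg _ _ fin21 cvg21.
have q32 := Q_cvg _ _ fin32 cvg32.
have q43 := Q_cvg _ _ fin43 cvg43.
have q33 : nu k ^+ 3 * q 3%N 3%N k @[k --> \oo] --> p 3%N 3%N.
  exact: q_cvg (dominated_cross_moment_cvg PnFin P1 PnP fin32 cvg32 (leqnSn 2)).
(* The pairs 13 and 24 of the path 12, 13, 24 are disjoint; this term is of
   lower order although P_42 itself may be infinite. *)
have q42 : nu k ^+ 3 * q 4%N 2%N k @[k --> \oo] --> (0 : R).
  rewrite -(mul0r 1) (_ : (fun k => _) = fun k =>
      fine (cross_moment (Pn k.+2) 4 2) / k.+2%:R *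
      (k.+2%:R ^+ 4 / (k.+2 ^_ 4)%:R)).
    exact: shift _ _ (cvgM (cross_momentS_ratio_cvg0 PnFin P1 PnP fin32 cvg32)
      (@ffact_ratio_cvg R 4)).
  apply/funext => k; rewrite /q /layer_contains_prob ; set D := (_ ^_ _)%:R^-1.
  rewrite -/(nu k); field; by rewrite gt_eqF.
have large : \forall k \near \oo, (0 < m k.+2)%N /\ (3 < k.+2)%N.
  have [N _ mN] := m_cvg _ (nbhs_infty_gt 0).
  exists (maxn N 2) => // k /=; rewrite geq_max => /andP[Nk k2].
  by split=> //; apply: mN => /=; rewrite (leq_trans Nk)// ltnW// ltnS leqnSn.
have bounds (Q : nat -> R) :
    (forall k, (0 < m k.+2)%N -> (3 < k.+2)%N -> 0 <= Q k <= 1) ->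
    \forall k \near \oo, 0 <= Q k <= 1.
  by move=> H; apply: filterS large => k [mk nk]; exact: H.
have b1 := bounds _ (fun k => misses1_bounds (M k) (PnFin k.+2)).
have b2 := bounds _ (fun k => misses_adjacent_bounds (M k) (PnFin k.+2)).
have b2' := bounds _ (fun k => misses_disjoint_bounds (M k) (PnFin k.+2)).
have b3t := bounds _ (fun k => misses_triangle_bounds (M k) (PnFin k.+2)).
have b3p := bounds _ (fun k => misses_path_bounds (M k) (PnFin k.+2)).
have b3s := bounds _ (fun k => misses_star_bounds (M k) (PnFin k.+2)).
pose u1 k := nu k * contains1 (m k.+2) (q 2%N 1%N k).
pose u2 k := nu k ^+ 2 * contains2 (m k.+2) (q 2%N 1%N k) (q 3%N 2%N k).
pose ut k := nu k ^+ 2 * contains3 (m k.+2) (q 2%N 1%N k) (q 3%N 2%N k)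
  (q 3%N 2%N k) (q 3%N 2%N k) (q 3%N 3%N k).
pose up k := nu k ^+ 3 * contains3 (m k.+2) (q 2%N 1%N k) (q 3%N 2%N k)
  (q 3%N 2%N k) (q 4%N 2%N k) (q 4%N 3%N k).
pose us k := nu k ^+ 3 * contains3 (m k.+2) (q 2%N 1%N k) (q 3%N 2%N k)
  (q 3%N 2%N k) (q 3%N 2%N k) (q 4%N 3%N k).
have u1_cvg : u1 @ \oo --> mu * p 2%N 1%N.
  exact: (contains1_cvg nu_gt0 nu_cvg mnu_cvg q21 b1).
have u2_cvg : u2 @ \oo --> mu * p 3%N 2%N + mu ^+ 2 * p 2%N 1%N ^+ 2.
  exact: (contains2_cvg nu_gt0 nu_cvg mnu_cvg q21 q32 b1 b2).
have ut_cvg : ut @ \oo --> mu * p 3%N 3%N.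
  exact: (contains3_triangle_cvg nu_gt0 nu_cvg mnu_cvg q21 q32 q32 q32
    b1 b2 b2 b2 b3t erefl erefl q33).
have up_cvg : up @ \oo --> mu * p 4%N 3%N +
    mu ^+ 2 * p 2%N 1%N * (p 3%N 2%N + p 3%N 2%N + 0) + mu ^+ 3 * p 2%N 1%N ^+ 3.
  exact: (contains3_cvg nu_gt0 nu_cvg mnu_cvg q21 q32 q32 q42 b1 b2 b2 b2' b3p q43).
have us_cvg : us @ \oo --> mu * p 4%N 3%N +
    mu ^+ 2 * p 2%N 1%N * (p 3%N 2%N + p 3%N 2%N + p 3%N 2%N) +
    mu ^+ 3 * p 2%N 1%N ^+ 3.
  exact: (contains3_cvg nu_gt0 nu_cvg mnu_cvg q21 q32 q32 q32 b1 b2 b2 b2 b3s q43).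
(* With n = k + 2, the numerators of [a] and [b] are n - 2 and n - 3, the numbers of further nodes
   in the degree moments. *)
pose a k : R := k%:R / nu k.
pose b k : R := k.-1%:R / nu k.
have one_sub_cvg (c : R) : 1 - c * (nu k)^-1 @[k --> \oo] --> (1 : R).
  rewrite -[X in _ --> X]subr0 -(mulr0 c).
  by apply: cvgB; [exact: cvg_cst|apply: cvgM => //; exact: cvg_cst].
have a_cvg : a @ \oo --> (1 : R).
  have h := one_sub_cvg 2; apply: cvg_trans h.
  apply: near_eq_cvg; apply: nearW => k /=; rewrite /a (_ : k%:R = nu k - 2).
    by field; rewrite gt_eqF.
  by rewrite /nu -addn2 natrD addrK.
have b_cvg : b @ \oo --> (1 : R).
  have h := one_sub_cvg 3; apply: cvg_trans h.
  (* The index 0 is excluded, since there the truncated predecessor differs from n - 3. *)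
  apply: near_eq_cvg; exists 1%N => // -[//|k] _ /=.
  rewrite /b /= (_ : k%:R = nu k.+1 - 3).
    by field; rewrite gt_eqF.
  by rewrite /nu -addn3 natrD addrK.
(* [s] is the conditional mean degree, [num] the covariance and [den] the variance, rewritten in
   quantities that converge: each factor n - 2 or n - 3 absorbs one power of n. *)
pose s k := 1 + a k * (u2 k / u1 k).
pose num k := 1 + 2 * a k * (u2 k / u1 k) + a k * (ut k / u1 k) +
  a k * b k * (up k / u1 k) - s k * s k.
pose den k := 1 + 3 * a k * (u2 k / u1 k) +
  a k * b k * (us k / u1 k) - s k * s k.
have u1_pos : \forall k \near \oo, 0 < u1 k.
  by apply: (cvgr_gt _ u1_cvg); rewrite mulr_gt0.
have assortE : \forall k \near \oo, num k / den k = model_assortativity (M k).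
  apply: filterS u1_pos => k uk; have nu0 : nu k != 0 by rewrite gt_eqF.
  have c0 : contains1 (m k.+2) (q 2%N 1%N k) != 0.
    by apply: contraTneq uk => c0; rewrite /u1 c0 mulr0 ltxx.
  rewrite /model_assortativity (conditional_expectation_degI (M k) (PnFin _))//.
  rewrite (conditional_expectation_degI2 (M k) (PnFin _))//.
  rewrite (conditional_expectation_degIJ (M k) (PnFin _))//=.
  congr (_ / _).
    rewrite /num /s /a /b /u1 /u2 /ut /up; field; rewrite c0 -natrD pnatr_eq0//.
  rewrite /den /s /a /b /u1 /u2 /us; field; rewrite c0 -natrD pnatr_eq0//.
move: a_gt0 p32_ge0 p33_le cs u1_cvg u2_cvg ut_cvg up_cvg us_cvg; rewrite /=.
move: (p 2%N 1%N) (p 3%N 2%N) (p 3%N 3%N) (p 4%N 3%N) => P21 P32 P33 P43.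
move=> P21_gt0 P32_ge0 P33_le cs u1_cvg.
set l1 := mu * P21 in u1_cvg.
set l2 := (X in u2 @ \oo --> X) => u2_cvg.
set lt := (X in ut @ \oo --> X) => ut_cvg.
set lp := (X in up @ \oo --> X) => up_cvg.
set ls := (X in us @ \oo --> X) => us_cvg.
have l1_neq0 : l1 != 0 by rewrite gt_eqF// mulr_gt0.
have ratio_cvg (u : nat -> R) (l : R) : u @ \oo --> l ->
    u k / u1 k @[k --> \oo] --> l / l1.
  by move=> ul; apply: cvgM => //; exact: cvgV.
have s_cvg : s @ \oo --> (1 + 1 * (l2 / l1) : R).
  by apply: cvgD; [exact: cvg_cst|apply: cvgM => //; exact: ratio_cvg].
have num_cvg : num @ \oo --> (1 + 2 * 1 * (l2 / l1) + 1 * (lt / l1) +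
    1 * 1 * (lp / l1) - (1 + 1 * (l2 / l1)) * (1 + 1 * (l2 / l1)) : R).
  apply: cvgB; last exact: cvgM.
  apply: cvgD; last by apply: cvgM; [exact: cvgM|exact: ratio_cvg].
  apply: cvgD; last by apply: cvgM => //; exact: ratio_cvg.
  apply: cvgD; first exact: cvg_cst.
  by apply: cvgM; [apply: cvgM => //; exact: cvg_cst|exact: ratio_cvg].
have den_cvg : den @ \oo --> (1 + 3 * 1 * (l2 / l1) +
    1 * 1 * (ls / l1) - (1 + 1 * (l2 / l1)) * (1 + 1 * (l2 / l1)) : R).
  apply: cvgB; last exact: cvgM.
  apply: cvgD; last by apply: cvgM; [exact: cvgM|exact: ratio_cvg].
  apply: cvgD; first exact: cvg_cst.
  by apply: cvgM; [apply: cvgM => //; exact: cvg_cst|exact: ratio_cvg].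
apply: cvg_trans (near_eq_cvg assortE) _.
have mu_neq0 : mu != 0 by rewrite gt_eqF.
have P21_neq0 : P21 != 0 by rewrite gt_eqF.
have D_gt0 : 0 < P21 * (P43 + P32) - P32 ^+ 2 + mu * P21 ^+ 2 * (P21 + P32).
  (* The difference is non-negative by [cs] and P33 <= P32; strict positivity comes from the term
     with [mu]. *)
  apply: ltr_wpDl; last by rewrite !mulr_gt0 ?exprn_gt0// ltr_pwDl.
  rewrite subr_ge0 (le_trans cs)// ler_wpM2l// ?lerD2l// ltW//.
set D := (X in _ / X); set N := (X in X / _).
(* The ratio l2 / l1 equals P32 / P21 + mu P21. In the numerator its square cancels every term of lp
   / l1 that contains [mu]; in the denominator the third mixed term of the star survives as mu P32,
   and the single l2 / l1 left over adds mu P21. *)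
have numE : N / P21 ^+ 2 = (1 + 2 * 1 * (l2 / l1) + 1 * (lt / l1) +
    1 * 1 * (lp / l1) - (1 + 1 * (l2 / l1)) * (1 + 1 * (l2 / l1))).
  by rewrite /N /l1 /l2 /lt /lp; field; rewrite mu_neq0 P21_neq0.
have denE : D / P21 ^+ 2 = 1 + 3 * 1 * (l2 / l1) +
    1 * 1 * (ls / l1) - (1 + 1 * (l2 / l1)) * (1 + 1 * (l2 / l1)).
  by rewrite /D /l1 /l2 /ls; field; rewrite mu_neq0 P21_neq0.
have D_neq0 : D != 0 by rewrite gt_eqF.
rewrite -numE in num_cvg; rewrite -denE in den_cvg.
rewrite (_ : N / D = (N / P21 ^+ 2) / (D / P21 ^+ 2)); last first.
  by field; rewrite P21_neq0 D_neq0.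
apply: cvgM => //; apply: cvgV => //.
by rewrite mulf_neq0// invr_eq0 expf_eq0.
Qed.
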